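(* Let $0\le l\le m\le n-1$. Let $A$ be a (unital) subalgebra of $\mathcal{RB}_n(\delta,\varepsilon)$ such that (i) as a $k$-module, $A$ is free on a subset of the rook-Brauer $n$-diagrams, and (ii) for each $i$ with $l\le i\le m$ and each right link state $p\in P_i$, if $A$ contains at least one diagram with right link state $p$, then $A$ contains an idempotent $e_p$ such that $A\cdot e_p=A\cap J_p$ as left ideals of $A$. Then there is a chain of isomorphisms of graded $k$-modules \[\operatorname{Ext}^{\star}_{A/(A\cap I_{l-1})}(\mathbf{1},\mathbf{1})\cong\operatorname{Ext}^{\star}_{A/(A\cap I_l)}(\mathbf{1},\mathbf{1})\cong\cdots\cong\operatorname{Ext}^{\star}_{A/(A\cap I_m)}(\mathbf{1},\mathbf{1}).\]
   Context: Let $k$ be a unital commutative ring, $n$ a positive integer, $\delta,\varepsilon\in k$. A rook-Brauer $n$-diagram is a graph on vertices $1,\dots,n$ (left column, top to bottom) and $\bar1,\dots,\bar n$ (right column) in which each edge joins two distinct vertices and each vertex lies on at most one edge; diagrams are determined by which pairs are joined. Edges joining the two columns are propagating, edges within one column non-propagating, vertices on no edge isolated. $\mathcal{RB}_n(\delta,\varepsilon)$ is the free $k$-module on these diagrams with product: identify the right column of $d_1$ with the left column of $d_2$ (middle column); let $\alpha$ be the number of closed loops lying in the middle column and $\beta$ the number of other connected components lying entirely in the middle column (isolated middle vertices, or paths with both ends in the middle column); let $d_3$ join two outer vertices iff they are joined by a path; $d_1d_2=\delta^\alpha\varepsilon^\beta d_3$. The identity has edges $\{i,\bar i\}$. For $-1\le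 i\le n-1$, $I_i$ is the two-sided ideal spanned by diagrams with at most $i$ propagating edges ($I_{-1}=0$). The augmentation $\tau:A\to k$ sends diagrams with $n$ propagating edges (permutation diagrams) to $1$ and all other diagrams to $0$; $\mathbf{1}$ is $k$ with $A$ acting via $\tau$; as $A\cap I_i$ ($i\le n-1$) lies in $\ker\tau$, $\mathbf{1}$ is also a module over $A/(A\cap I_i)$. The right link state of a diagram records, for each right vertex $\bar a$, whether it lies on a propagating edge (a defect at $\bar a$), is joined by a non-propagating edge to a specified $\bar b$, or is isolated. $P_i$ is the set of right link states of rook-Brauer $n$-diagrams with exactly $i$ defects. A splice replaces two defects by a non-propagating edge joining their vertices; a deletion replaces a defect by an isolated vertex. For a right link state $p$, $J_p$ is the left ideal of $\mathcal{RB}_n(\delta,\varepsilon)$ spanned by the diagrams whose right link state is obtained from $p$ by a (possibly empty) sequence of splices and deletions. *)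

(* Defs.v *)
From mathcomp Require Import all_boot all_algebra.
Set Implicit Arguments. Unset Strict Implicit. Unset Printing Implicit Defensive.
Import GRing.Theory.

(* A vertex is (false, i) = left vertex i, or (true, i) = right vertex i.   *)
(* A diagram is an involution f of the vertex set: f v = v means v is      *)
(* isolated, f v = w <> v means v and w are joined by an edge.             *)
Definition vtx (n : nat) := (bool * 'I_n)%type.

Definition rbdiag (n : nat) :=
  {f : {ffun vtx n -> vtx n} | [forall v, f (f v) == v]}.

Definition dapp n (d : rbdiag n) (v : vtx n) : vtx n := (val d) v.

Definition id_ffun n : {ffun vtx n -> vtx n} := [ffun v => (~~ v.1, v.2)].
Lemma id_ffun_inv n : [forall v, id_ffun n (id_ffun n v) == v].
Proof. by apply/forallP => -[b i]; rewrite !ffunE /= negbK. Qed.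
Definition idd n : rbdiag n := exist _ (id_ffun n) (id_ffun_inv n).

Definition prop n (d : rbdiag n) : nat :=
  #|[set i : 'I_n | (dapp d (false, i)).1]|.

(* Composition of diagrams: three columns (level 0 = left column of d1,   *)
(* level 1 = middle column, level 2 = right column of d2).                *)
Definition lvl0 : 'I_3 := @Ordinal 3 0 isT.
Definition lvl1 : 'I_3 := @Ordinal 3 1 isT.
Definition lvl2 : 'I_3 := @Ordinal 3 2 isT.
Definition vtx3 (n : nat) := ('I_3 * 'I_n)%type.

Definition emb1 n (v : vtx n) : vtx3 n := (if v.1 then lvl1 else lvl0, v.2).
Definition emb2 n (v : vtx n) : vtx3 n := (if v.1 then lvl2 else lvl1, v.2).
Definition embo n (v : vtx n) : vtx3 n := (if v.1 then lvl2 else lvl0, v.2).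

Section Compose.
Variables (n : nat) (d1 d2 : rbdiag n).

Definition cadj : rel (vtx3 n) := fun x y =>
  [exists v, (dapp d1 v != v) && (emb1 v == x) && (emb1 (dapp d1 v) == y)] ||
  [exists v, (dapp d2 v != v) && (emb2 v == x) && (emb2 (dapp d2 v) == y)].

Definition cconn (x y : vtx3 n) : bool := connect cadj x y.

Definition middle (x : vtx3 n) : bool := x.1 == lvl1.
Definition inmid (x : vtx3 n) : bool := [forall y, cconn x y ==> middle y].
Definition deg2 (y : vtx3 n) : bool :=
  (dapp d1 (true, y.2) != (true, y.2)) && (dapp d2 (false, y.2) != (false, y.2)).
Definition isloop (x : vtx3 n) : bool := [forall y, cconn x y ==> deg2 y].
Definition crep (x : vtx3 n) : bool :=
  [forall y, cconn x y ==> (enum_rank x <= enum_rank y)%N].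

Definition calpha : nat :=
  #|[set x | [&& middle x, inmid x, isloop x & crep x]]|.
Definition cbeta : nat :=
  #|[set x | [&& middle x, inmid x, ~~ isloop x & crep x]]|.

Definition comp_ffun : {ffun vtx n -> vtx n} :=
  [ffun u => odflt u [pick v | (v != u) && cconn (embo u) (embo v)]].
(* comp_ffun is always an involution; insub merely packages it *)
Definition comp : rbdiag n := odflt (idd n) (insub comp_ffun).
End Compose.

Local Open Scope ring_scope.

Definition RB (k : comPzRingType) (n : nat) := {ffun rbdiag n -> k}.

Definition rbbasis (k : comPzRingType) n (d : rbdiag n) : RB k n :=
  [ffun d' => ((d' == d) : nat)%:R].

Definition rbone (k : comPzRingType) n : RB k n := rbbasis k (idd n).

Definition rbmul (k : comPzRingType) n (delta eps : k) (x y : RB k n) : RB k n :=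
  [ffun d => \sum_(d1 : rbdiag n) \sum_(d2 : rbdiag n)
      x d1 * y d2 * (delta ^+ calpha d1 d2 * eps ^+ cbeta d1 d2
                      * ((comp d1 d2 == d) : nat)%:R)].

Definition inspan (k : comPzRingType) n (T : {set rbdiag n}) (x : RB k n) : bool :=
  [forall d, (x d != 0) ==> (d \in T)].

(* Right link states.  For a right vertex a:                              *)
(*   Some None      = defect at a,                                        *)
(*   Some (Some b)  = a joined by a non-propagating edge to \bar b,       *)
(*   None           = a isolated.                                         *)
Definition lstate (n : nat) := {ffun 'I_n -> option (option 'I_n)}.

Definition rls n (d : rbdiag n) : lstate n :=
  [ffun a => let w := dapp d (true, a) in
             if w == (true, a) then None
             else if w.1 then Some (Some w.2) else Some None].

Definition Pset n (i : nat) : {set lstate n} :=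
  [set rls d | d in [set d : rbdiag n | prop d == i]].

Definition lstep n : rel (lstate n) := fun p q =>
  [exists a, exists b, [&& a != b, p a == Some None, p b == Some None &
     q == [ffun x => if x == a then Some (Some b)
                     else if x == b then Some (Some a) else p x]]] ||
  [exists a, (p a == Some None) &&
     (q == [ffun x => if x == a then None else p x])].

Definition Jset n (p : lstate n) : {set rbdiag n} :=
  [set d | connect (@lstep n) p (rls d)].

(* Ext^j_R(1,1) for an augmented k-algebra R which is k-free on a finite  *)
(* basis T, with structure constants mul a b t (coefficient of t in a*b)  *)
(* and augmentation tau, computed by the (unnormalized) bar resolution:   *)
(* C^j = Hom_k(R^{(x)j}, k) = functions T^j -> k, with differential      *)
(* (df)(a1..a_{j+1}) = tau a1 f(a2..) + sum_i (-1)^i f(..,a_i a_{i+1},..) *)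
(*                     + (-1)^{j+1} f(a1..a_j) tau a_{j+1}.                *)
Section Bar.
Variables (k : comPzRingType) (T : finType) (mul : T -> T -> T -> k) (tau : T -> k).

Definition cochain (j : nat) := {ffun {ffun 'I_j -> T} -> k}.

Definition mergeAt j (a : {ffun 'I_j.+1 -> T}) (i : 'I_j) (t : T) : {ffun 'I_j -> T} :=
  [ffun x : 'I_j => if (x < i)%N then a (widen_ord (leqnSn j) x)
                    else if x == i then t else a (lift ord0 x)].

Definition dcob j (f : cochain j) : cochain j.+1 :=
  [ffun a : {ffun 'I_j.+1 -> T} =>
     tau (a ord0) * f [ffun x : 'I_j => a (lift ord0 x)]
   + \sum_(i < j) (-1) ^+ i.+1 *
       \sum_(t : T) mul (a (widen_ord (leqnSn j) i)) (a (lift ord0 i)) t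
                    * f (mergeAt a i t)
   + (-1) ^+ j.+1 * f [ffun x : 'I_j => a (widen_ord (leqnSn j) x)]
       * tau (a ord_max)].

Definition cocycle j (f : cochain j) : Prop := dcob f = [ffun => 0].

Definition coboundary j : cochain j -> Prop :=
  match j return cochain j -> Prop with
  | 0 => fun f => f = [ffun => 0]
  | j'.+1 => fun f => exists g : cochain j', f = dcob g
  end.
End Bar.

(* Ext^j(R1) ~= Ext^j(R2) as k-modules, where Ext^j = cocycles/coboundaries.
   F is the relation {(z, w) | phi [z] = [w]} for a k-linear isomorphism phi
   of the quotient modules. *)
Definition ext_iso (k : comPzRingType)
    (T1 : finType) (mul1 : T1 -> T1 -> T1 -> k) (tau1 : T1 -> k)
    (T2 : finType) (mul2 : T2 -> T2 -> T2 -> k) (tau2 : T2 -> k) (j : nat) : Prop :=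
  exists F : cochain k T1 j -> cochain k T2 j -> Prop,
  [/\ forall z w, F z w -> cocycle mul1 tau1 z /\ cocycle mul2 tau2 w,
      forall z, cocycle mul1 tau1 z -> exists w, F z w,
      forall w, cocycle mul2 tau2 w -> exists z, F z w,
      forall (c : k) z w z' w', F z w -> F z' w' ->
        F [ffun a => c * z a + z' a] [ffun a => c * w a + w' a] &
      forall z w z' w', F z w -> F z' w' ->
        (coboundary mul1 tau1 [ffun a => z a - z' a] <->
         coboundary mul2 tau2 [ffun a => w a - w' a])].

(* The quotient A/(A cap I_{q-1}) of A = span S: it is k-free on the     *)
(* diagrams of S with at least q propagating edges; products are those of *)
(* RB_n with diagrams of fewer than q propagating edges discarded.        *)
Definition qbasis n (S : {set rbdiag n}) (q : nat) :=
  {d : rbdiag n | (d \in S) && (q <= prop d)%N}.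

Definition qmul (k : comPzRingType) n (delta eps : k) (S : {set rbdiag n}) (q : nat)
    (a b t : qbasis S q) : k :=
  rbmul delta eps (rbbasis k (val a)) (rbbasis k (val b)) (val t).

Definition qtau (k : comPzRingType) n (S : {set rbdiag n}) (q : nat)
    (a : qbasis S q) : k := ((prop (val a) == n) : nat)%:R.

Definition ExtIsoLevels (k : comPzRingType) n (delta eps : k) (S : {set rbdiag n})
    (q1 q2 j : nat) : Prop :=
  ext_iso (@qmul k n delta eps S q1) (@qtau k n S q1)
          (@qmul k n delta eps S q2) (@qtau k n S q2) j.

(* Main.v *)
(* Let R = A/(A cap I_{q-1}) and let J be the span of its basis diagrams with exactly q propagating
   edges, so that R/J = A/(A cap I_q).  For a diagram x in J with right link state p one has
   x e_p = x, and a x is again supported on diagrams with right link state p; hence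
   x |-> x (x) e_p is a left R-linear section of the multiplication J (x) J -> J.
   Let K be the span, in the bar complex of R, of the words with a letter in J, so that the quotient
   by K is the bar complex of R/J.  Inserting e_p after the last letter x of J in a word is a
   homotopy from the identity of K to an operator that moves the last letter of J strictly to the
   right.  That operator is nilpotent in each degree, so K is acyclic and the two cohomologies agree.

   That R is associative with J an ideal is a statement about gluing diagrams.  Two involutions
   generate a dihedral action; an orbit containing a fixed point of one of them contains exactly
   two, so a connected component of a glued diagram is either a loop or a path with two ends.
   Eliminating one middle column of a three-fold product therefore preserves connectivity, the
   number of loops and the number of components of the other kind. *)
Require Import Defs.
From mathcomp Require Import all_boot all_algebra.
From mathcomp Require Import ring zify.
Set Implicit Arguments. Unset Strict Implicit. Unset Printing Implicit Defensive.
Import GRing.Theory.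
Local Open Scope ring_scope.

(** * The bar complex on words *)

Section BarSeq.
Variables (k : comPzRingType) (T : finType) (mul : T -> T -> T -> k) (tau : T -> k).
Implicit Types (f g z : seq T -> k).

(* A cochain is a function on words.  [dseq] is the bar differential by recursion on the first
   letter: [- dtail f a s] collects the faces of [a :: s] other than the one dropping [a]. *)
Fixpoint dtail f (a : T) (s : seq T) : k :=
  if s is b :: s' then
    \sum_t mul a b t * f (t :: s') - dtail (fun u => f (a :: u)) b s'
  else tau a * f [::].

Definition dseq f (s : seq T) : k :=
  if s is a :: s' then tau a * f s' - dtail f a s' else 0.

Lemma eq_dtail f g a s : (forall u, size u = size s -> f u = g u) ->
  dtail f a s = dtail g a s.
Proof.
elim: s f g a => [|b s IHs] f g a fg /=; first by rewrite fg.
congr (_ - _); first by apply: eq_bigr => t _; rewrite fg.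
by apply: IHs => u us; rewrite fg //= us.
Qed.

Lemma eq_dseq f g s : (forall u, size u = (size s).-1 -> f u = g u) ->
  dseq f s = dseq g s.
Proof. by case: s => //= a s fg; rewrite fg // (eq_dtail a fg). Qed.

Lemma dtailP (c : k) f g a s :
  dtail (fun u => c * f u + g u) a s = c * dtail f a s + dtail g a s.
Proof.
elim: s f g a => [|b s IHs] f g a /=; first by ring.
rewrite IHs; under eq_bigr => t _ do rewrite mulrDr mulrCA.
by rewrite big_split -mulr_sumr /=; ring.
Qed.

Lemma dseqP (c : k) f g s :
  dseq (fun u => c * f u + g u) s = c * dseq f s + dseq g s.
Proof. by case: s => [|a s] /=; rewrite ?dtailP; ring. Qed.

Lemma dtail0 a s : dtail (fun=> 0) a s = 0.
Proof.
rewrite (@eq_dtail _ (fun u => (-1) * 0 + 0)) => [|u _]; last by ring.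
by rewrite dtailP mulN1r addNr.
Qed.

Lemma dtail_eq0 f a s : (forall u, size u = size s -> f u = 0) -> dtail f a s = 0.
Proof. by move=> f0; rewrite (@eq_dtail _ (fun=> 0)) ?dtail0. Qed.

Lemma dtailB f g a s : dtail (fun u => f u - g u) a s = dtail f a s - dtail g a s.
Proof.
rewrite (@eq_dtail _ (fun u => (-1) * g u + f u)) => [|u _]; last by ring.
by rewrite dtailP; ring.
Qed.

Lemma dseqB f g s : dseq (fun u => f u - g u) s = dseq f s - dseq g s.
Proof. by case: s => [|a s] /=; rewrite ?dtailB; ring. Qed.

Lemma dtail_sum (c : T -> k) (F : T -> seq T -> k) a s :
  dtail (fun u => \sum_t c t * F t u) a s = \sum_t c t * dtail (F t) a s.
Proof.
elim: (index_enum T) => [|t r IHr]; first by rewrite big_nil dtail_eq0 // => u _; rewrite big_nil.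
rewrite big_cons -IHr -dtailP; apply: eq_dtail => u _.
by rewrite big_cons.
Qed.

Section Assoc.
Hypothesis mulA : forall a b c u,
  \sum_t mul a b t * mul t c u = \sum_t mul b c t * mul a t u.
Hypothesis tauM : forall a b, \sum_t mul a b t * tau t = tau a * tau b.

(** The identity behind d² = 0. By induction the tails that keep the letter [a] cancel, the merges
    of the first three letters agree by associativity, and the empty word needs [tauM]. *)
Lemma dtail_dtail f a b s :
  dtail (dtail f a) b s = \sum_t mul a b t * dtail f t s.
Proof.
elim: s f a b => [|c s IHs] f a b /=.
  by under eq_bigr => t _ do rewrite mulrA; rewrite -mulr_suml tauM; ring.
have -> : dtail (fun u => dtail f a (b :: u)) c s =
  \sum_t mul a b t * dtail (fun u => f (t :: u)) c s
  - \sum_t mul b c t * dtail (fun u => f (a :: u)) t s.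
  by rewrite -IHs -dtail_sum -dtailB; apply: eq_dtail.
under eq_bigr => t _ do rewrite mulrBr.
under [in RHS]eq_bigr => t _ do rewrite mulrBr.
rewrite !sumrB /= opprB addrA subrK; congr (_ - _).
under eq_bigr => t _ do rewrite mulr_sumr.
under [in RHS]eq_bigr => t _ do rewrite mulr_sumr.
rewrite exchange_big [in RHS]exchange_big; apply: eq_bigr => u _ /=.
under eq_bigr => t _ do rewrite mulrA.
under [in RHS]eq_bigr => t _ do rewrite mulrA.
by rewrite -!mulr_suml mulA.
Qed.

Lemma dtail_dseq f a s : dtail (dseq f) a s = tau a * dseq f s.
Proof.
case: s => [|b s] /=; first by rewrite mulr0.
rewrite (dtailB (fun u => tau a * f u) (dtail f a)) dtail_dtail.
have -> : dtail (fun u => tau a * f u) b s = tau a * dtail f b s.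
  rewrite (@eq_dtail _ (fun u => tau a * f u + 0)) => [|u _]; last by ring.
  by rewrite dtailP dtail0 addr0.
under eq_bigr => t _ do rewrite mulrBr mulrA.
by rewrite sumrB -mulr_suml tauM; ring.
Qed.

Lemma dseq_dseq f s : dseq (dseq f) s = 0.
Proof. by case: s => //= a s; rewrite dtail_dseq subrr. Qed.
End Assoc.

(** Extension by zero to words of other lengths; a tuple is identified with its word of values
    [codom]. *)
Definition seqc j (f : cochain k T j) (s : seq T) : k :=
  \sum_(a : {ffun 'I_j -> T}) (codom a == s)%:R * f a.
Definition cseq j (f : seq T -> k) : cochain k T j := [ffun a : {ffun 'I_j -> T} => f (codom a)].

Lemma codom_ffun_inj j : injective (fun a : {ffun 'I_j -> T} => codom a).
Proof.
by move=> a b /eq_in_map ab; apply/ffunP => i; apply: ab; rewrite mem_enum.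
Qed.

Lemma seqc_codom j (f : cochain k T j) (a : {ffun 'I_j -> T}) : seqc f (codom a) = f a.
Proof.
rewrite /seqc (bigD1 a) //= eqxx mul1r big1 ?addr0 // => b /negPf ba.
by rewrite (inj_eq (@codom_ffun_inj j)) ba mul0r.
Qed.

Lemma size_codom_ord j (a : {ffun 'I_j -> T}) : size (codom a) = j.
Proof. by rewrite size_codom card_ord. Qed.

Lemma codom_of_seq (s : seq T) j :
  size s = j -> exists a : {ffun 'I_j -> T}, codom a = s.
Proof.
move=> <-; exists [ffun i => tnth (in_tuple s) i].
rewrite -[RHS](map_tnth_enum (in_tuple s)); apply: eq_map => i; exact: ffunE.
Qed.

Lemma codom_ffunS j (a : {ffun 'I_j.+1 -> T}) :
  codom a = a ord0 :: codom [ffun x => a (lift ord0 x)].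
Proof.
rewrite !codomE enum_ordSl /= -map_comp; congr (_ :: _).
by apply: eq_map => x; rewrite /= ffunE.
Qed.

(** Peeling off one letter shifts every index of the alternating sum by one, and the minus sign in
    [dtail] supplies the extra factor -1. *)
Lemma dtail_codom j (f : seq T -> k) (a : {ffun 'I_j.+1 -> T}) :
  - dtail f (a ord0) (codom [ffun x => a (lift ord0 x)]) =
  \sum_(i < j) (-1) ^+ i.+1 *
       \sum_(t : T) mul (a (widen_ord (leqnSn j) i)) (a (lift ord0 i)) t
                    * f (codom (mergeAt a i t))
   + (-1) ^+ j.+1 * f (codom [ffun x : 'I_j => a (widen_ord (leqnSn j) x)])
       * tau (a ord_max).
Proof.
elim: j f a => [|j IHj] f a.
  have c0 (b : {ffun 'I_0 -> T}) : codom b = [::].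
    by apply/size0nil/size_codom_ord.
  by rewrite !c0 /= big_ord0 (_ : ord_max = ord0); [ring | apply/val_inj].
rewrite codom_ffunS !ffunE /= opprB addrC.
set a' := [ffun x => a (lift ord0 x)].
have -> : a (lift ord0 ord0) = a' ord0 by rewrite ffunE.
set s := codom _.
have sE : s = codom [ffun x => a' (lift ord0 x)].
  by congr (codom _); apply/ffunP => x; rewrite !ffunE.
rewrite -[dtail _ _ _]opprK sE IHj -sE big_ord_recl opprD !addrA.
congr (_ + _ + _).
- rewrite expr1 mulN1r; congr (- _); apply: eq_bigr => t _.
  rewrite (_ : widen_ord _ _ = ord0); last exact/val_inj.
  congr (_ * f _); first by rewrite !ffunE.
  rewrite [in RHS]codom_ffunS /mergeAt ffunE /= sE; congr (_ :: _).
  by apply: eq_codom => x; rewrite !ffunE.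
- rewrite -sumrN; apply: eq_bigr => i _; rewrite [in RHS]exprS mulN1r mulNr.
  congr (- (_ * _)); apply: eq_bigr => t _; rewrite !ffunE; congr (mul (a _) _ _ * f _).
    exact/val_inj.
  rewrite [in RHS]codom_ffunS /mergeAt !ffunE /=; congr (a _ :: _); first exact/val_inj.
  apply: eq_codom => x; rewrite !ffunE /= ltnS; case: ifP => // _.
  by congr (a _); apply/val_inj.
rewrite [in RHS]exprS mulN1r !mulNr; congr (- (_ * f _ * _)); last first.
  by rewrite ffunE; congr (tau (a _)); apply/val_inj.
rewrite [in RHS]codom_ffunS !ffunE; congr (a _ :: _); first exact/val_inj.
by apply: eq_codom => x; rewrite !ffunE; congr (a _); apply/val_inj.
Qed.

Lemma dcob_cseq j (f : seq T -> k) :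
  dcob mul tau (cseq j f) = cseq j.+1 (dseq f).
Proof.
apply/ffunP => a; rewrite !ffunE codom_ffunS /= dtail_codom addrA.
by congr (_ + _ + _); apply: eq_bigr => i _; congr (_ * _);
  apply: eq_bigr => t _; rewrite ffunE.
Qed.

Lemma seqcK j : cancel (@seqc j) (cseq j).
Proof. by move=> f; apply/ffunP => a; rewrite ffunE seqc_codom. Qed.

Lemma cseq_eq0 j f : cseq j f = [ffun=> 0] <-> forall s, size s = j -> f s = 0.
Proof.
split=> [/ffunP f0 s /codom_of_seq[a <-]|f0]; first by have := f0 a; rewrite !ffunE.
by apply/ffunP => a; rewrite !ffunE f0 ?size_codom_ord.
Qed.

Lemma cocycleE j (f : cochain k T j) :
  cocycle mul tau f <-> forall s, size s = j.+1 -> dseq (seqc f) s = 0.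
Proof. by rewrite /cocycle -{1}[f]seqcK dcob_cseq; apply: cseq_eq0. Qed.

(** One formula covers degree 0 as well, since [dseq g] is 0 on the empty word. *)
Lemma coboundaryE j (f : cochain k T j) :
  coboundary mul tau f <->
  exists g, forall s, size s = j -> seqc f s = dseq g s.
Proof.
split=> [|[g fg]].
  case: j f => [|j] f /= => [f0|[g ->]].
    exists (fun=> 0) => s /codom_of_seq[a <-].
    by rewrite seqc_codom f0 ffunE (size0nil (size_codom_ord a)).
  exists (seqc g) => s /codom_of_seq[a <-].
  by rewrite seqc_codom -{1}[g]seqcK dcob_cseq ffunE.
have {}fg : f = cseq j (dseq g).
  by apply/ffunP => a; rewrite ffunE -fg ?size_codom_ord ?seqc_codom.
case: j f fg => [|j] f -> /=; last by exists (cseq j g); rewrite dcob_cseq.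
by apply/ffunP => a; rewrite !ffunE (size0nil (size_codom_ord a)).
Qed.

End BarSeq.

(** * Acyclicity of the words meeting the ideal *)

Section Homotopy.
Variables (k : comPzRingType) (T : finType) (mul : T -> T -> T -> k) (tau : T -> k).
Variables (J : pred T) (e : T -> T -> k).
Implicit Types (f g z : seq T -> k).
Local Notation dtail := (dtail mul tau).
Local Notation dseq := (dseq mul tau).
Hypothesis mulA : forall a b c u,
  \sum_t mul a b t * mul t c u = \sum_t mul b c t * mul a t u.
Hypothesis tauM : forall a b, \sum_t mul a b t * tau t = tau a * tau b.
Hypothesis mulJl : forall a x t, J x -> ~~ J t -> mul a x t = 0.
Hypothesis mulJr : forall x a t, J x -> ~~ J t -> mul x a t = 0.
Hypothesis tauJ : forall x, J x -> tau x = 0.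

(** A face of a word meeting [J] either meets [J] or has coefficient 0, because [J] is an ideal
    killed by [tau]. Hence the cochains vanishing on words that meet [J] form a subcomplex. *)
Lemma dtail_eq0J f a s : (forall u, size u = size s -> has J u -> f u = 0) ->
  has J (a :: s) -> dtail f a s = 0.
Proof.
elim: s f a => [|b s IHs] f a f0; first by rewrite /= orbF => /tauJ->; rewrite mul0r.
move=> Jabs; rewrite /= big1 => [|t _].
  have [Jbs|nJbs] := boolP (has J (b :: s)).
    by rewrite IHs ?subr0 // => u us Ju; rewrite f0 //= ?us // Ju orbT.
  have Ja : J a by move: Jabs; rewrite /= -/(has J (b :: s)) (negPf nJbs) orbF.
  by rewrite dtail_eq0 ?subr0 // => u us; rewrite f0 /= ?us ?Ja.
have [Jts|] := boolP (has J (t :: s)); first by rewrite f0 ?mulr0.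
rewrite /= negb_or => /andP[nJt nJs].
move: Jabs; rewrite /= (negPf nJs) orbF => /orP[Ja|Jb].
  by rewrite mulJr ?mul0r.
by rewrite mulJl ?mul0r.
Qed.

Lemma dseq_eq0J f s : (forall u, size u = (size s).-1 -> has J u -> f u = 0) ->
  has J s -> dseq f s = 0.
Proof.
case: s => //= a s f0 Jas; rewrite (@dtail_eq0J f) // subr0.
have [Js|nJs] := boolP (has J s); first by rewrite f0 ?mulr0.
by move: Jas; rewrite (negPf nJs) orbF => /tauJ->; rewrite mul0r.
Qed.

(** [e x] lists the coefficients of the idempotent attached to a letter [x] of [J]. By [mule],
    inserting it after [x] is a section of the multiplication on [J]; by [e_mul] this section is
    left linear. *)
Hypothesis eJ : forall x v, J x -> ~~ J v -> e x v = 0.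
Hypothesis mule : forall x t, J x -> \sum_v e x v * mul x v t = (t == x)%:R.
Hypothesis e_mul : forall a x t v,
  J x -> J t -> mul a x t * e t v = mul a x t * e x v.

(* The number of letters after the last one in [J], with junk value [0] if there is none. *)
Fixpoint lastJ (s : seq T) : nat :=
  if s is a :: s' then if has J s' then lastJ s' else size s' else 0.

(* The (signed) evaluation of [z] on the word with [e x] inserted after its last [J]-letter [x]. *)
Fixpoint htpy z (s : seq T) : k :=
  if s is a :: s' then
    if has J s' then - htpy (fun u => z (a :: u)) s'
    else if J a then - \sum_v e a v * z [:: a, v & s'] else 0
  else 0.

(** A decreasing filtration of the cochains; on words of length [r], level [r] already means
    vanishing on all words that meet [J]. *)
Definition vanish_below r z := forall u, has J u -> (lastJ u < r)%N -> z u = 0.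

Lemma lastJ_lt s : has J s -> (lastJ s < size s)%N.
Proof.
elim: s => //= a s IHs _; case: ifP => // Js.
exact: leq_trans (IHs Js) _.
Qed.

Lemma vanish_cons r z a :
  vanish_below r z -> vanish_below r (fun u => z (a :: u)).
Proof. by move=> z0 u Ju ur; rewrite z0 //= Ju ?orbT. Qed.

Lemma eq_htpy f g s : f =1 g -> htpy f s = htpy g s.
Proof.
elim: s f g => //= a s IHs f g fg; rewrite (IHs _ (fun u => g (a :: u))) //.
by under eq_bigr => v _ do rewrite fg.
Qed.

Lemma htpyP (c : k) f g s :
  htpy (fun u => c * f u + g u) s = c * htpy f s + htpy g s.
Proof.
elim: s f g => [|a s IHs] f g /=; first by ring.
rewrite IHs; under eq_bigr => v _ do rewrite mulrDr mulrCA.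
rewrite big_split -mulr_sumr /=.
by case: ifP => _; [|case: ifP => _]; ring.
Qed.

Lemma htpyB f g s : htpy (fun u => f u - g u) s = htpy f s - htpy g s.
Proof.
rewrite (@eq_htpy _ (fun u => (-1) * g u + f u)) => [|u]; last by ring.
by rewrite htpyP; ring.
Qed.

Lemma htpy_eq0 f s : f =1 (fun=> 0) -> htpy f s = 0.
Proof.
elim: s f => //= a s IHs f f0; rewrite IHs ?oppr0 // big1 ?oppr0 ?if_same //.
by move=> v _; rewrite f0 mulr0.
Qed.

Lemma htpy_sum (c : T -> k) (F : T -> seq T -> k) s :
  htpy (fun u => \sum_t c t * F t u) s = \sum_t c t * htpy (F t) s.
Proof.
elim: (index_enum T) => [|t r IHr].
  by rewrite big_nil htpy_eq0 // => u; rewrite big_nil.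
rewrite big_cons -IHr -htpyP; apply: eq_htpy => u.
by rewrite big_cons.
Qed.

(** An inserted letter outside [J] has coefficient 0. One in [J] becomes the new last letter in [J],
    with as many letters after it as before. *)
Lemma htpy_below r z s : vanish_below r z -> has J s -> (lastJ s < r)%N ->
  htpy z s = 0.
Proof.
elim: s z => //= a s IHs z z0 Jas; case: ifP => Js sr.
  by rewrite IHs ?oppr0 //; apply: vanish_cons.
move: Jas; rewrite Js orbF => Ja; rewrite Ja big1 ?oppr0 // => v _.
have [Jv|nJv] := boolP (J v); last by rewrite eJ // mul0r.
by rewrite z0 ?mulr0 //= ?Ja // Jv Js.
Qed.

(** Here [x] is the only letter in [J]. In the word x v s, merging [x] with [v] gives back
    [z (x :: s)] by [mule]. Merging [v], or in the second term [x], with the first letter of [s]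
    leaves fewer than [r] letters after the last one in [J], so [z] kills the result; the remaining
    faces cancel. *)
Lemma dtail_htpy1 r z x s :
  vanish_below r z -> J x -> ~~ has J s -> (size s <= r)%N ->
  \sum_v e x v * dtail z x (v :: s) - dtail (htpy z) x s = z (x :: s).
Proof.
move=> z0 Jx nJs sr.
have -> : \sum_v e x v * dtail z x (v :: s) =
    z (x :: s) - \sum_v e x v * dtail (fun u => z (x :: u)) v s.
  under eq_bigr => v _ do rewrite /= mulrBr mulr_sumr.
  rewrite sumrB exchange_big /=; congr (_ - _).
  under eq_bigr => t _ do [under eq_bigr => v _ do rewrite mulrA; rewrite -mulr_suml mule //].
  rewrite (bigD1 x) //= eqxx mul1r big1 ?addr0 // => t /negPf->.
  by rewrite mul0r.
rewrite -addrA -opprD -[RHS]subr0; congr (_ - _).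
case: s nJs sr => [|b s] /= nJbs sr.
  rewrite tauJ // mul0r addr0 big1 // => v _.
  by have [/tauJ->|nJv] := boolP (J v); rewrite ?mul0r ?mulr0 // eJ // mul0r.
have nJs : has J s = false by apply: contraNF nJbs => ->; rewrite orbT.
have e0 v y : (J v -> y = 0) -> e x v * y = 0.
  by have [_ ->|nJv _] := boolP (J v); rewrite ?mulr0 // eJ ?mul0r.
have -> : \sum_t mul x b t * htpy z (t :: s) = 0.
  apply: big1 => t _; have [Jt|nJt] := boolP (J t); last by rewrite mulJr ?mul0r.
  by rewrite (@htpy_below r) ?mulr0 //= ?Jt ?nJs.
have -> : \sum_v e x v * (\sum_t mul v b t * z [:: x, t & s] -
      dtail (fun u => z [:: x, v & u]) b s) =
    - dtail (fun u => \sum_v e x v * z [:: x, v & u]) b s.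
  rewrite dtail_sum -sumrN; apply: eq_bigr => v _; rewrite mulrBr.
  rewrite [X in X - _]e0 => [|Jv]; first by rewrite sub0r.
  apply: big1 => t _.
  have [Jt|nJt] := boolP (J t); last by rewrite mulJr ?mul0r.
  by rewrite z0 ?mulr0 //= ?Jx ?Jt ?nJs.
rewrite sub0r -opprD.
(* The words [u] compared here may meet [J]; then both sides vanish, as fewer than [r] letters
   follow the last one in [J]. *)
have -> : dtail (fun u => htpy z (x :: u)) b s =
    dtail (fun u => 0 - \sum_v e x v * z [:: x, v & u]) b s.
  apply: eq_dtail => u us /=; rewrite Jx sub0r; case: ifP => // Ju.
  have ur : (lastJ u < r)%N by apply: leq_trans sr; rewrite ltnW // ltnS -us lastJ_lt.
  rewrite (@htpy_below r) //; last exact: vanish_cons.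
  congr (- _); apply/esym/big1 => v _; apply: e0 => Jv.
  by rewrite z0 //= ?Jv Ju ?orbT.
rewrite (dtailB _ _ (fun=> 0)) dtail0 sub0r addrN oppr0 //.
Qed.

(** Induction on the letters before the last one in [J]; the sign in [htpy] accounts for each letter
    passed. In the base case [a] is merged into the letter after which the insertion happens, and
    [e_mul] keeps the idempotent the same. *)
Lemma dtail_htpy r z a s : vanish_below r z -> has J s -> (lastJ s <= r)%N ->
  htpy (dtail z a) s - dtail (htpy z) a s = z (a :: s).
Proof.
elim: s z a => //= b s IHs z a z0 Jbs.
(* As [b :: s] meets [J], only words meeting [J] contribute, so the first branch alone counts. *)
have -> : dtail (fun u => if has J u then - htpy (fun u0 => z (a :: u0)) u
      else if J a then - \sum_v e a v * z [:: a, v & u] else 0) b s =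
    - dtail (htpy (fun u => z (a :: u))) b s.
  rewrite -sub0r -(dtail0 mul tau b s) -dtailB; apply/eqP; rewrite -subr_eq0 -dtailB.
  by apply/eqP/dtail_eq0J => // u _ ->; rewrite sub0r subrr.
case: ifP => Js sr.
  have -> : htpy (fun u => \sum_t mul a b t * z (t :: u)
                           - dtail (fun u => z (a :: u)) b u) s =
    \sum_t mul a b t * htpy (fun u => z (t :: u)) s
    - htpy (dtail (fun u => z (a :: u)) b) s.
    by rewrite -htpy_sum -htpyB.
  rewrite -(IHs _ b (@vanish_cons _ _ a z0) Js sr).
  rewrite opprB opprK; under [X in _ - (X + _)]eq_bigr => t _ do rewrite mulrN.
  by rewrite sumrN; ring.
move: Jbs; rewrite Js orbF => Jb; rewrite Jb.
rewrite -(@dtail_htpy1 r _ b s (@vanish_cons _ _ a z0)) ?Js //.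
under eq_bigr => v _ do rewrite mulrBr mulr_sumr.
rewrite sumrB exchange_big /= opprB.
have -> : \sum_t mul a b t * (if J t then - \sum_v e t v * z [:: t, v & s] else 0)
    = - \sum_t \sum_v e b v * (mul a b t * z [:: t, v & s]).
  rewrite -sumrN; apply: eq_bigr => t _; case: ifP => [Jt|/negbT nJt].
    rewrite mulrN mulr_sumr; congr (- _); apply: eq_bigr => v _.
    by rewrite [LHS]mulrA e_mul // -mulrA mulrCA.
  by rewrite mulr0 big1 ?oppr0 // => v _; rewrite mulJl // mul0r mulr0.
ring.
Qed.

Lemma htpy_dseq r z s : vanish_below r z -> has J s -> (lastJ s <= r)%N ->
  dseq (htpy z) s + htpy (dseq z) s = z s.
Proof.
case: s => //= a s z0; case: ifP => Js.
  rewrite orbT => _ sr; rewrite -(dtail_htpy a z0 Js sr).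
  have -> : htpy (fun u => tau a * z u - dtail z a u) s =
    tau a * htpy z s - htpy (dtail z a) s.
    rewrite htpyB (@eq_htpy _ (fun u => tau a * z u + 0)) => [|u]; last by ring.
    by rewrite htpyP (@htpy_eq0 (fun=> 0)) ?addr0.
  ring.
rewrite orbF => Ja sr; rewrite Ja tauJ // mul0r sub0r.
rewrite -(@dtail_htpy1 r z a s) ?Js //= addrC -sumrN; congr (_ - _).
by apply: eq_bigr => v _; rewrite mul0r sub0r mulrN opprK.
Qed.

(* Each step replaces [z] by [z - dseq (htpy z)], which vanishes one filtration level further. *)
Lemma vanish_cohomologous z r : (forall s, has J s -> dseq z s = 0) ->
  exists g, vanish_below r (fun u => z u - dseq g u).
Proof.
move=> dz0; elim: r => [|r [g z0]]; first by exists (fun=> 0).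
set y := fun u => _ in z0.
have dy0 s : has J s -> dseq y s = 0.
  by move=> Js; rewrite /y dseqB dseq_dseq // subr0 dz0.
(* [htpy] evaluates its argument only on words meeting [J], where [dseq y] vanishes. *)
have hdy0 s : htpy (dseq y) s = 0.
  move: (dseq y) dy0 => f; elim: s f => //= a s IHs f f0.
  case: ifP => Js; first by rewrite IHs ?oppr0 // => u Ju; rewrite f0 //= Ju orbT.
  by case: ifP => // Ja; rewrite big1 ?oppr0 // => v _; rewrite f0 ?mulr0 //= Ja.
exists (fun u => 1 * htpy y u + g u) => u Ju ur.
rewrite dseqP mul1r opprD addrCA addrC -/(y u) -[y u](htpy_dseq z0) //.
by rewrite hdy0 addr0 subrr.
Qed.

Lemma vanish_cohomologous_deg z j : (forall s, size s = j.+1 -> has J s -> dseq z s = 0) ->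
  exists g, forall u, size u = j -> has J u -> z u - dseq g u = 0.
Proof.
(* Cutting [z] off outside length [j] turns it into a cocycle on words meeting [J] of every length.
   Level [j] then suffices, since fewer than [j] letters follow the last one in [J]. *)
move=> dz0; pose z' u := if size u == j then z u else 0.
have [s Js|g g0] := @vanish_cohomologous z' j.
  have [sj|sj] := eqVneq (size s) j.+1.
    rewrite -[RHS](dz0 s) //; apply: eq_dseq => u us.
    by rewrite /z' us sj eqxx.
  rewrite (@eq_dseq _ _ _ _ z' (fun=> 0 - 0)) => [|u us]; last first.
    rewrite /z' us subrr; case: s Js sj {us} => //= a s _.
    by rewrite eqSS => /negPf->.
  by rewrite dseqB subrr.
exists g => u uj Ju; have := g0 u Ju; rewrite /z' uj eqxx; apply.
by rewrite -uj lastJ_lt.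
Qed.
End Homotopy.

(** * Excision: passing to the quotient by the ideal *)

Section Excision.
Variables (k : comPzRingType) (T1 T2 : finType).
Variables (mul1 : T1 -> T1 -> T1 -> k) (tau1 : T1 -> k).
Variables (mul2 : T2 -> T2 -> T2 -> k) (tau2 : T2 -> k).
Variables (J : pred T1) (e : T1 -> T1 -> k) (i : T2 -> T1) (pr : T1 -> option T2).
Hypothesis mulA : forall a b c u,
  \sum_t mul1 a b t * mul1 t c u = \sum_t mul1 b c t * mul1 a t u.
Hypothesis tauM : forall a b, \sum_t mul1 a b t * tau1 t = tau1 a * tau1 b.
Hypothesis mulJl : forall a x t, J x -> ~~ J t -> mul1 a x t = 0.
Hypothesis mulJr : forall x a t, J x -> ~~ J t -> mul1 x a t = 0.
Hypothesis tauJ : forall x, J x -> tau1 x = 0.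
Hypothesis eJ : forall x v, J x -> ~~ J v -> e x v = 0.
Hypothesis mule : forall x t, J x -> \sum_v e x v * mul1 x v t = (t == x)%:R.
Hypothesis e_mul : forall a x t v,
  J x -> J t -> mul1 a x t * e t v = mul1 a x t * e x v.
Hypothesis iK : pcancel i pr.
Hypothesis prK : forall a, ~~ J a -> omap i (pr a) = Some a.
Hypothesis iNJ : forall b, ~~ J (i b).
Hypothesis mul2E : forall a b t, mul2 a b t = mul1 (i a) (i b) (i t).
Hypothesis tau2E : forall a, tau2 a = tau1 (i a).

Let dseq1 := dseq mul1 tau1.
Let dseq2 := dseq mul2 tau2.

(** The two products differ by terms in [J], and [z] vanishes on the words that these produce. *)
Lemma dtail_map z a s :
    (forall u, size u = size s -> has J u -> z u = 0) ->
  dtail mul1 tau1 z (i a) (map i s) = dtail mul2 tau2 (fun u => z (map i u)) a s.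
Proof.
elim: s z a => [|b s IHs] z a z0 /=; first by rewrite tau2E.
rewrite IHs => [|u us Ju]; last by rewrite z0 //= ?us ?Ju ?orbT.
congr (_ - _); rewrite (bigID J) /= big1 ?add0r => [|t Jt]; last first.
  by rewrite z0 ?mulr0 //= ?size_map ?Jt.
rewrite (reindex_omap i pr prK) /=; apply: eq_big => [t|t _]; last by rewrite mul2E.
by rewrite iNJ iK eqxx.
Qed.

Lemma dseq_map z s :
    (forall u, size u = (size s).-1 -> has J u -> z u = 0) ->
  dseq1 z (map i s) = dseq2 (fun u => z (map i u)) s.
Proof.
by case: s => //= a s z0; rewrite /dseq1 /= dtail_map ?size_map // /dseq2 /= tau2E.
Qed.

(** Pullback of cochains along the quotient map, which sends the basis elements in [J] to 0. *)
Definition inflate (w : seq T2 -> k) (u : seq T1) : k :=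
  if has J u then 0 else w (pmap pr u).

Lemma inflateE w v : inflate w (map i v) = w v.
Proof.
rewrite /inflate (map_pK iK) ifF //; apply/hasPn => _ /mapP[b _ ->]; exact: iNJ.
Qed.

Lemma inflateJ w u : has J u -> inflate w u = 0.
Proof. by rewrite /inflate => ->. Qed.

Lemma map_of_notJ u : ~~ has J u -> exists2 v, size v = size u & u = map i v.
Proof.
elim: u => [_|a u IHu]; first by exists [::].
rewrite /= negb_or => /andP[/prK + /IHu[v <- ->]].
by case: (pr a) => //= b [<-]; exists (b :: v).
Qed.

Lemma dseq_inflate w u : dseq1 (inflate w) u = inflate (dseq2 w) u.
Proof.
have [Ju|/map_of_notJ[v _ ->]] := boolP (has J u).
  by rewrite inflateJ // /dseq1 (@dseq_eq0J _ _ _ _ J) // => v _; apply: inflateJ.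
rewrite inflateE dseq_map => [|x _]; last exact: inflateJ.
by apply: eq_dseq => x _; rewrite inflateE.
Qed.

(** Witnesses that the class of [z] is inflated from that of [w]: subtracting [dseq1 g] makes [z]
    descend to [w]. *)
Let comparable_cochains j (z : cochain k T1 j) (w : cochain k T2 j) : Prop :=
  exists2 g, forall u, size u = j -> has J u -> seqc z u - dseq1 g u = 0 &
    forall v, size v = j -> seqc w v = seqc z (map i v) - dseq1 g (map i v).

Lemma seqcP (T : finType) j (c : k) (z z' : cochain k T j) u : size u = j ->
  seqc [ffun a => c * z a + z' a] u = c * seqc z u + seqc z' u.
Proof. by case/codom_of_seq => a <-; rewrite !seqc_codom ffunE. Qed.

Lemma seqcB (T : finType) j (z z' : cochain k T j) u : size u = j ->
  seqc [ffun a => z a - z' a] u = seqc z u - seqc z' u.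
Proof. by case/codom_of_seq => a <-; rewrite !seqc_codom ffunE. Qed.

Lemma seqc_cseq (T : finType) j (f : seq T -> k) u : size u = j ->
  seqc (cseq j f) u = f u.
Proof. by case/codom_of_seq => a <-; rewrite seqc_codom ffunE. Qed.

Lemma dseqB1 f g s : dseq1 (fun u => f u - g u) s = dseq1 f s - dseq1 g s.
Proof. exact: dseqB. Qed.

Lemma dseq_dseq1 f s : dseq1 (dseq1 f) s = 0.
Proof. exact: dseq_dseq. Qed.

Lemma comparable_exists j (z : cochain k T1 j) : cocycle mul1 tau1 z ->
  exists w, cocycle mul2 tau2 w /\ comparable_cochains z w.
Proof.
move=> /cocycleE z0.
have [|g g0] := @vanish_cohomologous_deg _ _ mul1 tau1 J e mulA tauM mulJl mulJr tauJ eJ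
  mule e_mul (seqc z) j.
  by move=> s sj _; apply: z0.
pose w v := seqc z (map i v) - dseq1 g (map i v).
exists (cseq j w); split; last by exists g => // v vj; rewrite seqc_cseq.
apply/cocycleE => v vj.
rewrite -/dseq2 /dseq2 (@eq_dseq _ _ _ _ _ w) => [|u]; last first.
  by rewrite vj => uj; rewrite seqc_cseq.
rewrite -/dseq2 -(@dseq_map (fun u => seqc z u - dseq1 g u)) ?vj //.
by rewrite dseqB1 dseq_dseq1 /dseq1 z0 ?size_map // subrr.
Qed.

(** If [z] is the coboundary of [y], then the coboundary of [y - g] vanishes on words meeting [J].
    Acyclicity, used again one degree lower, makes [y - g] descend to the quotient up to a
    coboundary. *)
Lemma comparable_coboundary j (z : cochain k T1 j) (w : cochain k T2 j) : comparable_cochains z w ->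
  coboundary mul1 tau1 z <-> coboundary mul2 tau2 w.
Proof.
case=> g zg wE; split=> /coboundaryE[y yE]; apply/coboundaryE.
  case: j z w zg wE yE => [|j] z w zg wE yE.
    exists (fun=> 0) => s /size0nil->.
    by rewrite wE //= yE // /dseq1 /= subrr.
  have dE u : size u = j.+1 -> seqc z u - dseq1 g u = dseq1 (fun u => y u - g u) u.
    by move=> uj; rewrite dseqB1 yE.
  have [s sj Js|f f0] := @vanish_cohomologous_deg _ _ mul1 tau1 J e mulA tauM mulJl mulJr
    tauJ eJ mule e_mul (fun u => y u - g u) j.
    by rewrite -/dseq1 -dE // zg.
  exists (fun v => (y (map i v) - g (map i v)) - dseq1 f (map i v)) => v vj.
  rewrite wE // dE ?size_map // -/dseq2 -(@dseq_map (fun u => y u - g u - dseq1 f u)).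
    by rewrite (dseqB1 (fun u => y u - g u)) dseq_dseq1 subr0.
  by rewrite vj.
exists (fun u => 1 * inflate y u + g u) => u uj.
rewrite dseqP mul1r -/dseq1 dseq_inflate.
have [Ju|/map_of_notJ[v vu uE]] := boolP (has J u).
  by rewrite inflateJ // add0r; apply/eqP; rewrite -subr_eq0 zg.
by rewrite uE inflateE /dseq2 -yE ?wE ?vu // subrK.
Qed.

Lemma ext_iso_excision j : ext_iso mul1 tau1 mul2 tau2 j.
Proof.
exists (fun z w => [/\ cocycle mul1 tau1 z, cocycle mul2 tau2 w & comparable_cochains z w]).
split.
- by move=> z w [].
- by move=> z z0; have [w []] := comparable_exists z0; exists w.
- move=> w w0; have /cocycleE dw0 := w0.
  have infE u : size u = j -> seqc (cseq j (inflate (seqc w))) u = inflate (seqc w) u.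
    exact: seqc_cseq.
  exists (cseq j (inflate (seqc w))); split => //.
    apply/cocycleE => u uj.
    rewrite (@eq_dseq _ _ _ _ _ (inflate (seqc w))) => [|v vj]; last by rewrite infE ?vj ?uj.
    rewrite -/dseq1 dseq_inflate /inflate; case: ifP => // /negbT/map_of_notJ[v vu ->].
    by rewrite (map_pK iK) /dseq2 dw0 ?vu.
  (* The zero cochain, written as a difference so that [dseqB1] shows its coboundary to be 0. *)
  exists (fun=> 0 - 0) => [u uj Ju|v vj]; rewrite dseqB1 subrr subr0 infE ?size_map //.
    by rewrite inflateJ.
  by rewrite inflateE.
- move=> c z w z' w' [z0 w0 [g zg wg]] [z'0 w'0 [g' zg' wg']]; split.
  + apply/cocycleE => s sj; rewrite (@eq_dseq _ _ _ _ _ (fun u => c * seqc z u + seqc z' u)).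
      by rewrite dseqP (cocycleE _ _ _).1 // (cocycleE _ _ _).1 // mulr0 addr0.
    by move=> u; rewrite sj => uj; apply: seqcP.
  + apply/cocycleE => s sj; rewrite (@eq_dseq _ _ _ _ _ (fun u => c * seqc w u + seqc w' u)).
      by rewrite dseqP (cocycleE _ _ _).1 // (cocycleE _ _ _).1 // mulr0 addr0.
    by move=> u; rewrite sj => uj; apply: seqcP.
  exists (fun u => c * g u + g' u) => [u uj Ju|v vj]; rewrite /dseq1 dseqP !seqcP ?size_map //.
    have -> : seqc z u = dseq1 g u by apply/eqP; rewrite -subr_eq0 zg.
    have -> : seqc z' u = dseq1 g' u by apply/eqP; rewrite -subr_eq0 zg'.
    exact: subrr.
  by rewrite wg // wg' // /dseq1; ring.
move=> z w z' w' [_ _ [g zg wg]] [_ _ [g' zg' wg']]; apply: comparable_coboundary.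
exists (fun u => g u - g' u) => [u uj Ju|v vj]; rewrite dseqB1 !seqcB ?size_map //.
  have -> : seqc z u = dseq1 g u by apply/eqP; rewrite -subr_eq0 zg.
  have -> : seqc z' u = dseq1 g' u by apply/eqP; rewrite -subr_eq0 zg'.
  exact: subrr.
by rewrite wg // wg' //; ring.
Qed.

End Excision.

(** * Components generated by involutions *)

Section Generated.
Variables (X : finType) (fs : seq (X -> X)).

Definition gconn : rel X := connect (fun x y => has (fun f => f x == y) fs).

Lemma gconn_refl x : gconn x x.
Proof. exact: connect0. Qed.

Lemma gconn_trans y x z : gconn x y -> gconn y z -> gconn x z.
Proof. exact: connect_trans. Qed.

Lemma gconn1 x y : has (fun f => f x == y) fs -> gconn x y.
Proof. exact: connect1. Qed.

Lemma gconn_ind (P : pred X) x y : (forall z, P z -> all (fun f => P (f z)) fs) ->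
  P x -> gconn x y -> P y.
Proof.
move=> PS Px /connectP[p + ->] {y}; elim: p x Px => //= y p IHp x Px /andP[xy].
apply: IHp; have: all (fun f => P (f x)) fs by apply: PS.
elim: fs xy => //= f gs IHgs /orP[/eqP<- /andP[]//|xy /andP[_]]; exact: IHgs.
Qed.

Lemma gconn_sub gs x y : (forall z, all (fun f => gconn z (f z)) gs) ->
  connect (fun x y => has (fun f => f x == y) gs) x y -> gconn x y.
Proof.
move=> sgs; apply: connect_sub => {}x {}y.
by elim: gs {sgs} (sgs x) => //= f gs IHgs /andP[xf /IHgs{}IHgs] /orP[/eqP<-|].
Qed.

Lemma gconn_sym : (forall x, all (fun f => f (f x) == x) fs) -> symmetric gconn.
Proof.
move=> fK; apply: sym_connect_sym => x y; apply/idP/idP.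
  by elim: fs (fK x) => //= f gs IHgs /andP[/eqP fx gx]
    /orP[/eqP<-|/(IHgs gx)->]; rewrite ?fx ?eqxx ?orbT.
by elim: fs (fK y) => //= f gs IHgs /andP[/eqP fx gx]
  /orP[/eqP<-|/(IHgs gx)->]; rewrite ?fx ?eqxx ?orbT.
Qed.
End Generated.

Section Dihedral.
Variables (X : finType) (a b : X -> X).
Hypotheses (aK : involutive a) (bK : involutive b).
Implicit Types (x : X) (p : bool * X).

(** A pair is a point with a choice of involution, and a fixed pair is an end of a path. A point
    fixed by both involutions is a path of length 0 and still counts as two ends. *)
Definition flip2 p : X := if p.1 then a p.2 else b p.2.
Definition fixed2 p : bool := flip2 p == p.2.

(** [rot2] walks along a component, alternating the involutions, and [rev2] turns round; [rot2_rev]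
    is the dihedral relation. *)
Let rot2 p := (~~ p.1, flip2 p).
Let rev2 p := (~~ p.1, p.2).

Let rot2_inj : injective rot2.
Proof.
move=> [[] x] [[] y] // [] E; congr (_, _).
  exact: (inv_inj aK).
exact: (inv_inj bK).
Qed.

Let rot2_rev p : rot2 (rev2 (rot2 p)) = rev2 p.
Proof. by case: p => [[] x]; rewrite /rot2 /rev2 /flip2 /= ?aK ?bK. Qed.

Let iter_rot2_rev m p : iter m rot2 (rev2 (iter m rot2 p)) = rev2 p.
Proof. by elim: m => //= m IHm; rewrite -iterS iterSr rot2_rev. Qed.

Let iter_rot2_inj m : injective (iter m rot2).
Proof. by elim: m => //= m IHm p q /rot2_inj/IHm. Qed.

Let fixed2E p : fixed2 p = (rot2 p == rev2 p).
Proof. by case: p => x y; rewrite /rot2 /rev2 xpair_eqE eqxx. Qed.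

(** At an end the walk turns round, [rot2 p = rev2 p]; so the walk of [m] steps reaches an end
    exactly if [m] more steps lead back to [p]. *)
Let fixed2_iter m p : fixed2 p -> fixed2 (iter m rot2 p) = (iter m.*2 rot2 p == p).
Proof.
rewrite !fixed2E => /eqP pE.
rewrite -(inj_eq (@iter_rot2_inj m)) iter_rot2_rev -pE.
by rewrite -iterS -iterD addnS addnn iterS (inj_eq rot2_inj).
Qed.

Let odd_iter m p : (iter m rot2 p).1 = odd m (+) p.1.
Proof. by elim: m => //= m ->; case: (odd m); case: p.1. Qed.

Let gab := gconn [:: a; b].

Let gconn_flip p : gab p.2 (flip2 p).
Proof. by apply: gconn1; case: p => [[] x]; rewrite /flip2 /= eqxx ?orbT. Qed.

Let gconn_iter m p : gab p.2 (iter m rot2 p).2.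
Proof.
elim: m => [|m IHm] /=; first exact: gconn_refl.
exact: gconn_trans IHm (gconn_flip _).
Qed.

Let orbit_gconn p q : fixed2 p -> gab p.2 q.2 -> fconnect rot2 p q.
Proof.
move=> fp; have rC := fconnect_sym rot2_inj.
(* Since the walk turns round at [p], its orbit contains both pairs over each point of the class. *)
pose P x := fconnect rot2 p (true, x) && fconnect rot2 p (false, x).
have PP z : P z -> all (fun f => P (f z)) [:: a; b].
  have rot1 r : fconnect rot2 p r -> fconnect rot2 p (rot2 r).
    by move/connect_trans; apply; apply: fconnect1.
  have rotV r : fconnect rot2 p (rot2 r) -> fconnect rot2 p r.
    by move/connect_trans; apply; rewrite rC fconnect1.
  case/andP=> zt zf; have {zt} := (rot1 _ zt, zt); have {zf} := (rot1 _ zf, zf).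
  rewrite /rot2 /flip2 /= /P => -[-> zf] [-> zt] /=.
  rewrite (rotV (true, a z)) ?(rotV (false, b z)) // /rot2 /flip2 /= ?aK ?bK //.
have Pp : P p.2.
  have p0 : fconnect rot2 p p by exact: connect0.
  have p1 : fconnect rot2 p (rot2 p) by exact: fconnect1.
  move: p0 p1 fp; rewrite /P fixed2E => p0 p1 /eqP pE; move: p0 p1; rewrite pE.
  by case: (p) => [[] x] /= *; apply/andP; split.
by move=> /(gconn_ind PP Pp)/andP[]; case: q => [[] y].
Qed.

(* A class with at least one fixed pair has exactly two: if [p] is fixed and the rotation has order
   [N] at [p], then [N] is even, and the fixed pairs are the rotates of [p] by [0] and [N/2]. *)
Lemma two_fixed2 p : fixed2 p ->
  exists q, [/\ q != p, fixed2 q, gconn [:: a; b] p.2 q.2 &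
    forall r, fixed2 r -> gconn [:: a; b] p.2 r.2 -> r = p \/ r = q].
Proof.
move=> fp; have [m mD] : exists m, m = order rot2 p by eexists.
have m_gt0 : (0 < m)%N by rewrite mD order_gt0.
have itm : iter m rot2 p = p by rewrite mD iter_order.
(* Each step switches the involution, so returning to [p] takes an even number of steps. *)
have m_odd : odd m = false.
  by have := odd_iter m p; rewrite itm; case: (odd m); case: p.1.
have mE : (m./2).*2 = m by rewrite -[RHS]odd_double_half m_odd.
have iter_eq0 i : (i < m)%N -> iter i rot2 p = p -> i = 0%N.
  by move=> im ip; rewrite mD in im; rewrite -(findex_iter im) ip findex0.
exists (iter m./2 rot2 p); split.
- apply/eqP => /iter_eq0 m0; have m2 : m./2 = 0%N by apply: m0; lia.
  by move: m_gt0; rewrite -mE m2.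
- by rewrite fixed2_iter // mE itm.
- exact: gconn_iter.
move=> r fr /(orbit_gconn fp) pr; have im := findex_max pr; rewrite -mD in im.
rewrite -(iter_findex pr); rewrite -(iter_findex pr) fixed2_iter // in fr.
move: (findex rot2 p r) im (eqP fr) => i im ip {r fr pr}.
(* The double of [i] is 0 modulo the order [m]; with [i < m] this leaves 0 and half of [m]. *)
have [i2m|mi2] := ltnP i.*2 m.
  by left; have := iter_eq0 _ i2m ip; case: i {im i2m ip}.
right; have [|] := leqP i m./2 => imh; first by congr (iter _ _ _); lia.
have := iter_eq0 (i.*2 - m)%N; rewrite -{1}itm.
rewrite -iterD subnK // ip => H; suff : (i.*2 - m = 0)%N by lia.
apply: H => //; lia.
Qed.
End Dihedral.

(** * Eliminating a middle column *)

(* The involution on the complement of [M] that joins the two ends of each path through [M]. *)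
Definition contract (X : finType) (a b : X -> X) (M : pred X) (x : X) : X :=
  if M x then x
  else odflt x [pick v | [&& v != x, ~~ M v & gconn [:: a; b] x v]].

(* Points whose class lies in [M] and, according to [t], does or does not lie in [dg].  With [dg]
   the points of degree two, these are the points on loops ([t = true]) or on paths ending in [M]. *)
Definition enclosed (X : finType) (R : rel X) (M dg : pred X) (t : bool) : pred X :=
  [pred x | [forall y, R x y ==> M y] && ([forall y, R x y ==> dg y] == t)].

Definition nclass (X : finType) (R : rel X) (P : pred X) : nat :=
  #|[set [set y | R x y] | x in P]|.

Definition moved2 (X : eqType) (a b : X -> X) : pred X :=
  fun y => (a y != y) && (b y != y).

Section Contract.
Variables (X : finType) (a b : X -> X) (M : pred X).
Hypotheses (aK : involutive a) (bK : involutive b).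
Hypothesis abM : forall x, ~~ M x -> (a x == x) || (b x == x).

Local Notation E := (gconn [:: a; b]).
Local Notation h := (contract a b M).

Let E_sym : symmetric E.
Proof. by apply: gconn_sym => x; rewrite /= aK bK !eqxx. Qed.

Let E_a x : E x (a x). Proof. by apply: gconn1; rewrite /= eqxx. Qed.
Let E_b x : E x (b x). Proof. by apply: gconn1; rewrite /= eqxx orbT. Qed.

Lemma fixed2_boundary x : ~~ M x -> exists s, fixed2 a b (s, x).
Proof. by move=> /abM/orP[]; [exists true | exists false]. Qed.

(** By [abM] a point outside [M] is an end of its path, and a path has only two ends. *)
Lemma boundary_uniq x y z : ~~ M x -> ~~ M y -> E x y -> E x z -> x != y ->
  (exists s, fixed2 a b (s, z)) -> z = x \/ z = y.
Proof.
move=> /fixed2_boundary[s fx] /fixed2_boundary[s' fy] xy xz nxy [s'' fz].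
have [q [_ _ _ q_uniq]] := two_fixed2 aK bK fx.
have [/(congr1 snd)/= yx|yq] := q_uniq (s', y) fy xy; first by rewrite yx eqxx in nxy.
have [/(congr1 snd)/= ->|] := q_uniq (s'', z) fz xz; first by left.
by rewrite -yq => /(congr1 snd)/= ->; right.
Qed.

(** The class of [x] has at most one other point outside [M], so the choice made by [pick] is
    forced. *)
Lemma contractE x y : ~~ M x -> x != y -> (h x == y) = ~~ M y && E x y.
Proof.
move=> Mx nxy; rewrite /contract (negPf Mx); case: pickP => [v|] /=.
  case/and3P=> vx Mv xv; apply/eqP/andP => [<- //|[My xy]].
  rewrite eq_sym in vx; have [yx|->//] := boundary_uniq Mx Mv xv xy vx (fixed2_boundary My).
  by rewrite yx eqxx in nxy.
by move/(_ y); rewrite eq_sym nxy /= => ->; apply/negbTE.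
Qed.

Lemma contract_id x : M x -> h x = x.
Proof. by rewrite /contract => ->. Qed.

Lemma contract_conn x : E x (h x).
Proof.
rewrite /contract; case: ifP => _; first exact: gconn_refl.
by case: pickP => [v /and3P[]|_] //; apply: gconn_refl.
Qed.

Lemma contract_boundary x : ~~ M x -> ~~ M (h x).
Proof.
move=> Mx; rewrite /contract (negPf Mx).
by case: pickP => [v /and3P[]|].
Qed.

Lemma contractK : involutive h.
Proof.
move=> x; have [Mx|Mx] := boolP (M x); first by rewrite !contract_id.
have [hx|hx] := eqVneq (h x) x; first by rewrite !hx.
by apply/eqP; rewrite contractE ?contract_boundary // Mx E_sym contract_conn.
Qed.

Section Third.
Variable c : X -> X.
Hypothesis cK : involutive c.
Hypothesis cM : forall x, M x -> c x = x.
Local Notation R := (gconn [:: a; b; c]).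
Local Notation H := (gconn [:: h; c]).

Let R_sym : symmetric R.
Proof. by apply: gconn_sym => x; rewrite /= aK bK cK !eqxx. Qed.

Lemma sub_gconn3 x y : E x y -> R x y.
Proof. by apply: gconn_sub => z /=; rewrite !gconn1 //= eqxx ?orbT. Qed.

Lemma sub_contract3 x y : H x y -> R x y.
Proof.
by apply: gconn_sub => z /=; rewrite sub_gconn3 ?contract_conn // gconn1 //= eqxx !orbT.
Qed.

(** A path is cut at its visits outside [M]: contracted steps and [c]-steps lead to [w], and an
    incomplete passage through [M] remains. *)
Lemma gconn3_boundary x z : ~~ M x -> R x z ->
  exists w, [&& ~~ M w, H x w & E w z].
Proof.
move=> Mx xz; apply/existsP; move: xz.
apply: (@gconn_ind _ _ (fun z => [exists w, [&& ~~ M w, H x w & E w z]])).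
  move=> {}z /existsP[w /and3P[Mw xw wz]] /=; rewrite andbT.
  apply/and3P; split; apply/existsP.
  - by exists w; rewrite Mw xw (gconn_trans wz).
  - by exists w; rewrite Mw xw (gconn_trans wz).
  have [Mz|Mz] := boolP (M z); first by exists w; rewrite cM // Mw xw.
  have Mcz : ~~ M (c z) by apply: contra Mz => /[dup]/cM; rewrite cK => <-.
  exists (c z); rewrite Mcz gconn_refl andbT /=.
  have wHz : H w z.
    have [->|wz'] := eqVneq w z; first exact: gconn_refl.
    by apply: gconn1; rewrite /= contractE // Mz wz.
  by apply: gconn_trans (gconn_trans xw wHz) _; apply: gconn1; rewrite /= eqxx orbT.
by apply/existsP; exists x; rewrite Mx !gconn_refl.
Qed.

Lemma gconn3_contract x y : ~~ M x -> ~~ M y -> R x y = H x y.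
Proof.
move=> Mx My; apply/idP/idP => [/(gconn3_boundary Mx)[w /and3P[Mw xw wy]]|].
  have [<-//|wy'] := eqVneq w y.
  by apply: (gconn_trans xw); apply: gconn1; rewrite /= contractE // My wy.
exact: sub_contract3.
Qed.

Lemma contract_boundary_conn x y : ~~ M x -> H x y -> ~~ M y.
Proof.
apply: (@gconn_ind _ _ (fun z => ~~ M z)) => z Mz /=.
rewrite contract_boundary // andbT /=.
by apply: contra Mz => /[dup]/cM; rewrite cK => <-.
Qed.

Section Count.
Variable N : pred X.
Hypothesis MN : forall x, M x -> ~~ N x.
Hypothesis aN : forall x, N x -> a x = x.
Let MuN : pred X := fun x => M x || N x.

(** Degree two in either middle column: [c] fixes [M] and [a] fixes [N], so the disjunction selects
    the relevant involution. *)
Definition moved3 : pred X := fun y => (b y != y) && ((a y != y) || (c y != y)).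

Let NnM x : N x -> ~~ M x.
Proof. by apply: contraL => /MN. Qed.

(** Contraction preserves being a loop. With degree two throughout, a passage from a point of [N]
    can only end at another point outside [M]. Conversely, a break inside [M] would be a third end
    of a passage that already has two ends outside [M]. *)
Lemma moved3_contract y : N y -> (forall z, R y z -> MuN z) ->
  [forall z, R y z ==> moved3 z] = [forall z, H y z ==> moved2 h c z].
Proof.
move=> Ny yMN; have My := NnM Ny; apply/idP/idP => /forall_inP mv; apply/forall_inP => z yz.
  have Mz := contract_boundary_conn My yz.
  have yRz := sub_contract3 yz.
  have Nz : N z by have := yMN z yRz; rewrite /MuN (negPf Mz).
  have := mv z yRz; rewrite /moved3 /moved2 aN // eqxx /= => /andP[bz ->].
  rewrite andbT; have fz : fixed2 a b (true, z) by rewrite /fixed2 /flip2 /= aN.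
  have [[s w] [nw fw zw _]] := two_fixed2 aK bK fz; rewrite /= in zw.
  have yRw : R y w by apply: gconn_trans yRz (sub_gconn3 zw).
  have {mv} := mv w yRw; rewrite /moved3 => /andP[bw acw].
  move: fw nw; case: s; rewrite /fixed2 /flip2 /= ?(negPf bw) // => /eqP fw nw.
  have Mw : ~~ M w by apply: contraL acw => Mw; rewrite fw cM // eqxx.
  have {}nw : z != w by apply: contraNneq nw => ->.
  suff /eqP-> : h z == w by rewrite eq_sym.
  by rewrite contractE // Mw.
have [Mz|Mz] := boolP (M z).
  have [w /and3P[Mw yw wz]] := gconn3_boundary My yz.
  have /andP[hw _] := mv w yw; have Mhw := contract_boundary Mw.
  have nfix s : ~ fixed2 a b (s, z).
    move=> fz; rewrite eq_sym in hw.
    by have [] := boundary_uniq Mw Mhw (contract_conn w) wz hw (ex_intro _ s fz) => e;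
      [move: Mw | move: Mhw]; rewrite -e Mz.
  apply/andP; split; last (apply/orP; left); apply/negP; [exact: nfix false|exact: nfix true].
have /mv/andP[hz cz] : H y z by rewrite -gconn3_contract.
have Nz : N z by have := yMN z yz; rewrite /MuN (negPf Mz).
rewrite /moved3 cz orbT andbT; apply: contra hz => bz.
suff /eqP-> : pred1 z (h z) by [].
apply: gconn_ind (contract_conn z) => /= [u /eqP->|]; last exact: eqxx.
by rewrite aN // bz eqxx.
Qed.

Let cls (Q : rel X) x := [set y | Q x y].

Let cls_eq (Q : rel X) x y : symmetric Q -> transitive Q -> Q x y -> cls Q x = cls Q y.
Proof.
move=> Qs Qt xy; apply/setP => z; rewrite !inE; apply/idP/idP; last exact: Qt.
by apply: Qt; rewrite Qs.
Qed.

Let R_trans : transitive R. Proof. by move=> y x z; apply: gconn_trans. Qed.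

Let P t := enclosed R MuN moved3 t.

Let P_closed t x y : R x y -> P t x -> P t y.
Proof.
move=> xy; have e z : R x z = R y z.
  by apply/idP/idP; apply: R_trans; rewrite ?(R_sym y).
have eP (Q : pred X) : [forall z, R y z ==> Q z] = [forall z, R x z ==> Q z].
  by apply: eq_forallb => z; rewrite e.
by rewrite /P /enclosed /= (eP MuN) (eP moved3).
Qed.

Let gconn_M x y : (forall z, E x z -> M z) -> R x y = E x y.
Proof.
move=> xM; apply/idP/idP; last exact: sub_gconn3.
apply: gconn_ind (gconn_refl _ _) => z xz /=.
by rewrite (gconn_trans xz (E_a z)) (gconn_trans xz (E_b z)) cM ?xz // xM.
Qed.

Let enclosed_M t x : (forall z, R x z -> ~~ N z) -> P t x = enclosed E M (moved2 a b) t x.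
Proof.
move=> xN; apply/andP/andP => -[/forall_inP xM /eqP xt].
  have {}xM z : R x z -> M z by move=> xz; have := xM z xz; rewrite /MuN (negPf (xN z xz)) orbF.
  have RE z : R x z = E x z by apply: gconn_M => y /sub_gconn3/xM.
  split; first by apply/forall_inP => z; rewrite -RE => /xM.
  rewrite -xt; apply/eqP/eq_forallb => z; rewrite -RE; case xz: (R x z) => //=.
  by rewrite /moved2 /moved3 (cM (xM z xz)) eqxx orbF andbC.
have RE z : R x z = E x z by apply: gconn_M.
split; first by apply/forall_inP => z; rewrite RE => /xM; rewrite /MuN => ->.
rewrite -xt; apply/eqP/eq_forallb => z; rewrite RE; case xz: (E x z) => //=.
by rewrite /moved2 /moved3 (cM (xM z xz)) eqxx orbF andbC.
Qed.

Let enclosed_N t x : N x -> P t x = enclosed H N (moved2 h c) t x.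
Proof.
move=> Nx; have Mx := NnM Nx; apply/andP/andP => -[/forall_inP xN /eqP xt].
  split; last by rewrite -moved3_contract ?xt.
  apply/forall_inP => z xz; have := xN z (sub_contract3 xz).
  by rewrite /MuN (negPf (contract_boundary_conn Mx xz)).
have xMN z : R x z -> MuN z.
  move=> xz; rewrite /MuN; have [//|Mz] := boolP (M z).
  by rewrite xN // -gconn3_contract.
split; first exact/forall_inP.
by rewrite moved3_contract ?xt.
Qed.

(** Enclosed components avoiding [N] lie in [M] and are classes for [a] and [b]. Those meeting [N]
    become classes of the contracted gluing when their points in [M] are deleted. *)
Lemma nclass_contract t :
  (nclass E (enclosed E M (moved2 a b) t) + nclass H (enclosed H N (moved2 h c) t))%N
    = nclass R (enclosed R MuN moved3 t).
Proof.
rewrite /nclass -/(cls _).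
pose A := [set cls E x | x in enclosed E M (moved2 a b) t].
pose B := [set cls R x | x in [pred x | N x && P t x]].
have -> : [set cls R x | x in enclosed R MuN moved3 t] = A :|: B.
  apply/setP => K; rewrite inE; apply/imsetP/orP => [[x Px ->]|[]/imsetP[x Px ->]].
  - have [/existsP[y /andP[xy Ny]]|/existsPn xN] := boolP [exists y, R x y && N y].
      right; apply/imsetP; exists y; last exact: cls_eq.
      by rewrite inE Ny (P_closed xy).
    have {}xN z : R x z -> ~~ N z by move=> xz; have := xN z; rewrite xz.
    left; apply/imsetP; exists x; first by rewrite -[_ \in _](enclosed_M t xN).
    apply/setP => z; rewrite !inE; apply: gconn_M => y /sub_gconn3 xy.
    by have /andP[/forall_inP/(_ y xy)] := Px; rewrite /MuN (negPf (xN y xy)) orbF.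
  - have /andP[/forall_inP xM _] := Px.
    have RE z : R x z = E x z by apply: gconn_M.
    exists x; last by apply/setP => z; rewrite !inE RE.
    by rewrite -[_ \in _]/(P t x) enclosed_M // => z; rewrite RE => /xM/MN.
  by have /andP[_ ?] := Px; exists x.
have AB : [disjoint A & B].
  apply/pred0P => K /=; apply/negbTE/negP => /andP[/imsetP[x /andP[/forall_inP xM _] ->]].
  case/imsetP=> y /andP[Ny _] /setP/(_ y); rewrite !inE gconn_refl => /xM/MN.
  by rewrite Ny.
rewrite cardsU (disjoint_setI0 AB) cards0 subn0; congr (_ + _)%N.
have -> : [set cls H x | x in enclosed H N (moved2 h c) t] =
    [set [set z in K | ~~ M z] | K : {set X} in B].
  have phi x : N x -> [set z in cls R x | ~~ M z] = cls H x.
    move=> Nx; have Mx := NnM Nx; apply/setP => z; rewrite !inE.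
    have [Mz|Mz] := boolP (M z); last by rewrite andbT gconn3_contract.
    by rewrite andbF; apply/esym/negbTE; apply: contraL Mz; apply: contract_boundary_conn.
  apply/setP => K; apply/imsetP/imsetP => [[x Px ->]|[_ /imsetP[x /andP[Nx Px] ->] ->]].
    have Nx : N x by have /andP[/forall_inP-> //] := Px; apply: gconn_refl.
    exists (cls R x); rewrite ?phi //; apply/imsetP; exists x => //.
    by rewrite inE Nx enclosed_N.
  by exists x; rewrite ?phi // -[_ \in _](enclosed_N t Nx).
(* A class meeting [N] is recovered from any of its points outside [M]. *)
apply: card_in_imset => _ _ /imsetP[x /andP[Nx _] ->] /imsetP[y /andP[Ny _] ->] /setP/(_ y).
rewrite !inE gconn_refl NnM //= andbT => xy; apply: cls_eq => //.
Qed.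

End Count.
End Third.
End Contract.

(** * Relabelling the points along an injection *)

Section Transport.
Variables (X Y : finType) (i : X -> Y) (a b : X -> X) (a' b' : Y -> Y).
Variables (M : pred X) (M' : pred Y).
Hypothesis i_inj : injective i.
Hypothesis ai : forall x, a' (i x) = i (a x).
Hypothesis bi : forall x, b' (i x) = i (b x).
Hypothesis Mi : forall x, M' (i x) = M x.

Local Notation E := (gconn [:: a; b]).
Local Notation E' := (gconn [:: a'; b']).

Lemma gconn_codom x y' : E' (i x) y' -> exists2 y, E x y & y' = i y.
Proof.
move=> xy'; suff /exists_inP[y xy /eqP->] : [exists (y | E x y), y' == i y] by exists y.
apply: (gconn_ind (P := fun y' => [exists (y | E x y), y' == i y])) xy'.
  move=> z' /exists_inP[z xz /eqP->] /=; rewrite ai bi andbT.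
  apply/andP; split; apply/exists_inP; [exists (a z)|exists (b z)] => //;
    by apply: gconn_trans xz _; apply: gconn1; rewrite /= eqxx ?orbT.
by apply/exists_inP; exists x; rewrite ?gconn_refl.
Qed.

Lemma gconn_inj x y : E' (i x) (i y) = E x y.
Proof.
apply/idP/idP => [/gconn_codom[z xz /i_inj->]//|xy].
apply: (gconn_ind (P := fun z => E' (i x) (i z))) xy; last exact: gconn_refl.
by move=> z xz /=; rewrite andbT -ai -bi; apply/andP; split;
  apply: gconn_trans xz _; apply: gconn1; rewrite /= eqxx ?orbT.
Qed.

Lemma forall_gconn_inj x (P : pred X) (P' : pred Y) : (forall y, E x y -> P' (i y) = P y) ->
  [forall y', E' (i x) y' ==> P' y'] = [forall y, E x y ==> P y].
Proof.
move=> PP; apply/forall_inP/forall_inP => [P'x y xy|Px _ /gconn_codom[y xy ->]].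
  by rewrite -PP // P'x ?gconn_inj.
by rewrite PP ?Px.
Qed.

Lemma nclass_transport t : (forall y', M' y' -> exists y, y' = i y) ->
  nclass E' (enclosed E' M' (moved2 a' b') t) = nclass E (enclosed E M (moved2 a b) t).
Proof.
move=> Mim.
have enclE x : (i x \in enclosed E' M' (moved2 a' b') t) = (x \in enclosed E M (moved2 a b) t).
  rewrite !inE (@forall_gconn_inj _ M) // (@forall_gconn_inj _ (moved2 a b)) //.
  by move=> y _; rewrite /moved2 ai bi !(inj_eq i_inj).
rewrite /nclass -[RHS](card_imset _ (imset_inj i_inj)) -imset_comp.
have cls x : [set y' | E' (i x) y'] = i @: [set y | E x y].
  apply/setP => y'; rewrite inE; apply/idP/imsetP => [/gconn_codom[y xy ->]|[y + ->]].
    by exists y; rewrite ?inE.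
  by rewrite inE gconn_inj.
apply: eq_card => K; apply/imsetP/imsetP => [[x' Px' ->]|[x Px ->]].
  have [|x xE] := Mim x'.
    by have /andP[/forall_inP-> //] := Px'; apply: gconn_refl.
  rewrite xE in Px' *; exists x; last exact: cls.
  by rewrite -enclE.
by exists (i x); rewrite /= ?cls ?enclE.
Qed.

Hypotheses (aK : involutive a) (bK : involutive b).
Hypotheses (aK' : involutive a') (bK' : involutive b').
Hypothesis abM : forall x, ~~ M x -> (a x == x) || (b x == x).
Hypothesis abM' : forall x, ~~ M' x -> (a' x == x) || (b' x == x).

Lemma contract_transport x : contract a' b' M' (i x) = i (contract a b M x).
Proof.
have [Mx|Mx] := boolP (M x); first by rewrite !contract_id ?Mi.
have Mx' : ~~ M' (i x) by rewrite Mi.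
have [hx|hx] := eqVneq (contract a b M x) x; last first.
  apply/eqP; rewrite contractE //; last by rewrite (inj_eq i_inj) eq_sym.
  by rewrite Mi contract_boundary ?gconn_inj ?contract_conn.
rewrite hx; apply/eqP/negPn/negP => hx'.
have [w xw wE] := gconn_codom (contract_conn a' b' M' (i x)).
have xw' : x != w by apply: contraNneq hx' => xw'; rewrite wE -xw'.
have : contract a b M x == w.
  by rewrite contractE // xw andbT -Mi -wE contract_boundary.
by rewrite hx (negPf xw').
Qed.
End Transport.

Lemma gconn_swap (X : finType) (a b : X -> X) : gconn [:: a; b] =2 gconn [:: b; a].
Proof. by apply: eq_connect => x y /=; rewrite !orbF orbC. Qed.

Lemma contractC (X : finType) (a b : X -> X) M : contract a b M =1 contract b a M.
Proof.
move=> x; rewrite /contract; case: ifP => // _; congr (odflt x _).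
by apply: eq_pick => v; rewrite /= gconn_swap.
Qed.

Lemma eq_nclass (X : finType) (R R' : rel X) (M M' dg dg' : pred X) t :
  R =2 R' -> M =1 M' -> dg =1 dg' ->
  nclass R (enclosed R M dg t) = nclass R' (enclosed R' M' dg' t).
Proof.
move=> RR MM DD; rewrite /nclass; apply: eq_card.
have eE : enclosed R M dg t =i enclosed R' M' dg' t.
  move=> x; rewrite !inE; congr (_ && (_ == t)); apply: eq_forallb => y;
    by rewrite RR ?MM ?DD.
move=> K; apply/imsetP/imsetP => -[x Px ->]; exists x.
- by rewrite -eE.
- by apply/setP => y; rewrite !inE RR.
- by rewrite eE.
by apply/setP => y; rewrite !inE RR.
Qed.

(** Representatives of least rank are how [calpha] and [cbeta] count components, through [crep]. *)
Lemma nclass_rep (X : finType) (R : rel X) (P : pred X) :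
  reflexive R -> symmetric R -> transitive R -> (forall x y, R x y -> P x -> P y) ->
  #|[set x | P x && [forall y, R x y ==> (enum_rank x <= enum_rank y)%N]]| = nclass R P.
Proof.
move=> Rr Rs Rt Pcl; rewrite /nclass.
set A := [set x | _]; rewrite -(card_in_imset (f := fun x => [set y | R x y]) (D := A)).
  apply: eq_card => K; apply/imsetP/imsetP => -[x].
    by rewrite inE => /andP[Px _] ->; exists x.
  move=> Px ->; have [y xy ymin] := arg_minnP (fun y => enum_rank y : nat) (Rr x).
  exists y; last first.
    apply/setP => z; rewrite !inE; apply/idP/idP; last exact: Rt.
    by apply: Rt; rewrite Rs.
  rewrite inE (Pcl x y) //=; apply/forall_inP => z yz.
  by apply: ymin; apply: Rt yz.
move=> x y; rewrite !inE => /andP[_ /forall_inP xm] /andP[_ /forall_inP ym].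
move=> /setP/(_ y); rewrite !inE Rr => xy; apply/enum_rank_inj/val_inj/anti_leq.
by rewrite xm // ym // Rs.
Qed.

Lemma dappK n (d : rbdiag n) : involutive (dapp d).
Proof. by move=> v; apply/eqP; have /forallP := valP d; apply. Qed.

Lemma dapp_inj n (d d' : rbdiag n) : dapp d =1 dapp d' -> d = d'.
Proof. by move=> dd; apply/val_inj/ffunP. Qed.

(** * Gluing diagrams *)

Section Place.
Variables (C : finType) (n : nat).

Definition emb (p r : C) (v : vtx n) : C * 'I_n := (if v.1 then r else p, v.2).

(* The diagram [d] drawn between columns [p] and [r] of a strip whose columns are indexed by [C]. *)
Definition place (p r : C) (d : rbdiag n) (y : C * 'I_n) : C * 'I_n :=
  if y.1 == p then emb p r (dapp d (false, y.2))
  else if y.1 == r then emb p r (dapp d (true, y.2)) else y.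

Lemma emb_inj p r : p != r -> injective (emb p r).
Proof.
move=> pr [[] x] [[] y] [] // => [->|e _|e _|->] //; by rewrite e eqxx in pr.
Qed.

Lemma place_emb p r d v : p != r -> place p r d (emb p r v) = emb p r (dapp d v).
Proof. by case: v => [[] x] pr; rewrite /place /= ?eqxx // eq_sym (negPf pr). Qed.

Lemma place_id p r d y : y.1 != p -> y.1 != r -> place p r d y = y.
Proof. by rewrite /place => /negPf-> /negPf->. Qed.

Lemma embP p r y : [\/ exists v, y = emb p r v | y.1 != p /\ y.1 != r].
Proof.
case: y => z x /=; have [->|] := eqVneq z p; first by left; exists (false, x).
by have [->|] := eqVneq z r; [left; exists (true, x) | right].
Qed.

Lemma placeK p r d : p != r -> involutive (place p r d).
Proof.
move=> pr y; have [[v ->]|[yp yr]] := embP p r y; last by rewrite !place_id.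
by rewrite !place_emb // dappK.
Qed.
End Place.

Section Columns.
Variables (C : finType) (n : nat) (p m r : C) (d1 d2 : rbdiag n).
Hypotheses (pm : p != m) (mr : m != r) (pr : p != r).

Let i (y : vtx3 n) : C * 'I_n :=
  (if y.1 == lvl0 then p else if y.1 == lvl1 then m else r, y.2).

Let i_inj : injective i.
Proof.
move=> [x u] [y v] [+ ->]; case: x => [[|[|[|//]]] ?]; case: y => [[|[|[|//]]] ?] //= e;
  try (congr (_, _); exact: val_inj);
  by move: pm mr pr; rewrite ?e ?eqxx // -?e ?eqxx.
Qed.

Let i_emb01 v : emb p m v = i (emb lvl0 lvl1 v). Proof. by case: v => [[] x]. Qed.
Let i_emb12 v : emb m r v = i (emb lvl1 lvl2 v). Proof. by case: v => [[] x]. Qed.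
Let i_emb02 v : emb p r v = i (emb lvl0 lvl2 v). Proof. by case: v => [[] x]. Qed.

Let lvlP (y : vtx3 n) : [\/ y.1 = lvl0, y.1 = lvl1 | y.1 = lvl2].
Proof.
by case: y => [[[|[|[|//]]] ?] u] /=; [apply: Or31|apply: Or32|apply: Or33]; apply: val_inj.
Qed.

Let place_i1 y : place p m d1 (i y) = i (place lvl0 lvl1 d1 y).
Proof.
have [[v ->]|[y0 y1]] := embP lvl0 lvl1 y; first by rewrite -i_emb01 !place_emb // i_emb01.
have [e|e|y2] := lvlP y; [by rewrite e in y0|by rewrite e in y1|].
by rewrite !place_id //= y2 /= eq_sym.
Qed.

Let place_i2 y : place m r d2 (i y) = i (place lvl1 lvl2 d2 y).
Proof.
have [[v ->]|[y1 y2]] := embP lvl1 lvl2 y; first by rewrite -i_emb12 !place_emb // i_emb12.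
have [y0|e|e] := lvlP y; [|by rewrite e in y1|by rewrite e in y2].
by rewrite !place_id //= y0.
Qed.

Let place_boundary (D : finType) (q s t : D) (e1 e2 : rbdiag n) x : q != s -> q != t ->
  ~~ (x.1 == s) -> (place q s e1 x == x) || (place s t e2 x == x).
Proof.
move=> qs qt xs; have [xq|xq] := eqVneq x.1 q; last by rewrite place_id ?eqxx.
by rewrite orbC place_id ?eqxx // xq.
Qed.

Let cconnE : cconn d1 d2 =2 gconn [:: place lvl0 lvl1 d1; place lvl1 lvl2 d2].
Proof.
move=> x y; apply/idP/idP.
  apply: connect_sub => {}x {}y /orP[] /existsP[v /andP[/andP[_ /eqP<-] /eqP<-]].
    by apply: gconn1; rewrite /= (@place_emb _ _ lvl0 lvl1) // eqxx.
  by apply: gconn1; rewrite /= (@place_emb _ _ lvl1 lvl2) // eqxx orbT.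
apply: connect_sub => {}x {}y /=; rewrite orbF => /orP[] /eqP<- {y}.
  have [[v ->]|[y0 y1]] := embP lvl0 lvl1 x; last by rewrite place_id.
  rewrite place_emb //; have [->|dv] := eqVneq (dapp d1 v) v; first exact: connect0.
  by apply/connect1/orP; left; apply/existsP; exists v; rewrite dv !eqxx.
have [[v ->]|[y0 y1]] := embP lvl1 lvl2 x; last by rewrite place_id.
rewrite place_emb //; have [->|dv] := eqVneq (dapp d2 v) v; first exact: connect0.
by apply/connect1/orP; right; apply/existsP; exists v; rewrite dv !eqxx.
Qed.

Let h3 := contract (place lvl0 lvl1 d1) (place lvl1 lvl2 d2) (@middle n).

Let middleE u : @middle n (emb lvl0 lvl2 u) = false.
Proof. by case: u => [[] x]. Qed.

Let h3E u v : u != v -> (h3 (emb lvl0 lvl2 u) == emb lvl0 lvl2 v) = cconn d1 d2 (embo u) (embo v).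
Proof.
move=> uv; rewrite contractE ?middleE ?cconnE //; try exact: placeK.
  by move=> x; apply: place_boundary.
by rewrite (inj_eq (@emb_inj _ _ lvl0 lvl2 _)).
Qed.

Let h3_emb u : exists v, h3 (emb lvl0 lvl2 u) = emb lvl0 lvl2 v.
Proof.
have := @contract_boundary _ (place lvl0 lvl1 d1) (place lvl1 lvl2 d2) (@middle n)
  (emb lvl0 lvl2 u); rewrite -/h3 middleE => /(_ isT).
have [[v ->]|[y0 y2]] := embP lvl0 lvl2 (h3 (emb lvl0 lvl2 u)); first by exists v.
have [e|e|e] := lvlP (h3 (emb lvl0 lvl2 u)); first by rewrite e in y0.
  by rewrite /middle e.
by rewrite e in y2.
Qed.

(** Composition is contraction of the middle column; that [comp_ffun] is an involution will then
    follow from [contractK]. *)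
Let emb_comp_ffun u : emb lvl0 lvl2 (comp_ffun d1 d2 u) = h3 (emb lvl0 lvl2 u).
Proof.
rewrite ffunE; case: pickP => [v /andP[vu uv]|none] /=.
  by apply/esym/eqP; rewrite h3E // eq_sym.
have [w hw] := h3_emb u; rewrite hw; have [->//|uw] := eqVneq u w.
have := none w; rewrite eq_sym uw /= -h3E // hw eqxx //.
Qed.

Let emb_comp u : emb lvl0 lvl2 (dapp (Defs.comp d1 d2) u) = h3 (emb lvl0 lvl2 u).
Proof.
rewrite -emb_comp_ffun; congr emb; rewrite /dapp /Defs.comp insubT //.
apply/forallP => v; apply/eqP/(@emb_inj _ _ lvl0 lvl2 isT).
rewrite !emb_comp_ffun /h3 contractK //; try exact: placeK.
by move=> x; apply: place_boundary.
Qed.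

Lemma dapp_comp (u v : vtx n) : u != v ->
  (dapp (Defs.comp d1 d2) u == v) = gconn [:: place p m d1; place m r d2] (emb p r u) (emb p r v).
Proof.
move=> uv; rewrite -(inj_eq (@emb_inj _ n lvl0 lvl2 isT)) emb_comp h3E // cconnE.
by rewrite !i_emb02 (gconn_inj i_inj place_i1 place_i2).
Qed.

Let isM : pred (C * 'I_n) := fun y => y.1 == m.

Let isM_i y : isM (i y) = middle y.
Proof.
rewrite /isM /middle /=; have [->|->|->] := lvlP y; rewrite ?eqxx ?(negPf pm) //.
by rewrite /= eq_sym (negPf mr).
Qed.

Lemma contract_place : contract (place p m d1) (place m r d2) isM =1 place p r (Defs.comp d1 d2).
Proof.
move=> y; have [[u ->]|[yp yr]] := embP p r y.
  rewrite place_emb // !i_emb02 emb_comp.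
  apply: (contract_transport i_inj place_i1 place_i2 isM_i); try exact: placeK;
    by move=> x; apply: place_boundary.
rewrite place_id //; have [ym|ym] := boolP (isM y); first by rewrite contract_id.
suff /eqP : pred1 y (contract (place p m d1) (place m r d2) isM y) by [].
apply: gconn_ind (contract_conn _ _ _ y) => [z /eqP->|] /=; last exact: eqxx.
by rewrite !place_id // !eqxx.
Qed.

Lemma nclass_place t :
  nclass (gconn [:: place p m d1; place m r d2])
    (enclosed (gconn [:: place p m d1; place m r d2]) isM
              (moved2 (place p m d1) (place m r d2)) t) =
  if t then calpha d1 d2 else cbeta d1 d2.
Proof.
rewrite (nclass_transport i_inj place_i1 place_i2 isM_i); last first.
  by move=> [z x] /eqP/= ->; exists (lvl1, x).
set E := gconn _; have Es : symmetric E.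
  by apply: gconn_sym => x; rewrite /= !placeK ?eqxx.
have Et : transitive E by move=> y x z; apply: gconn_trans.
have Er : reflexive E by move=> x; apply: gconn_refl.
have eqE x y z : E x y -> E x z = E y z.
  by move=> xy; apply/idP/idP; apply: Et; rewrite // Es.
rewrite -nclass_rep //; last first.
  move=> x y /eqE xy; rewrite /enclosed /=.
  have eP (Q : pred (vtx3 n)) : [forall z, E y z ==> Q z] = [forall z, E x z ==> Q z].
    by apply: eq_forallb => z; rewrite xy.
  by rewrite (eP (@middle n)) (eP (moved2 _ _)).
have loopE x : inmid d1 d2 x ->
    isloop d1 d2 x = [forall y, E x y ==> moved2 (place lvl0 lvl1 d1) (place lvl1 lvl2 d2) y].
  move=> /forallP xm; apply: eq_forallb => y; have := xm y; rewrite cconnE -/E.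
  case: (E x y) => //= ym; case: y ym => [z j] /eqP /= ->; rewrite /deg2 /moved2 /=.
  rewrite -[(lvl1, j)]/(emb lvl0 lvl1 (true, j)) place_emb // (inj_eq (@emb_inj _ _ _ _ _)) //.
  rewrite -[emb _ _ _]/(emb lvl1 lvl2 (false, j)) place_emb // (inj_eq (@emb_inj _ _ _ _ _)) //.
have midE x : [forall y, E x y ==> middle y] = inmid d1 d2 x.
  by apply: eq_forallb => y; rewrite cconnE.
have repE x : [forall y, E x y ==> (enum_rank x <= enum_rank y)%N] = crep d1 d2 x.
  by apply: eq_forallb => y; rewrite cconnE.
have inmE x : inmid d1 d2 x -> middle x.
  by move/forallP/(_ x); rewrite cconnE gconn_refl.
case: t; apply: eq_card => x; rewrite !inE /enclosed /= midE repE;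
  case: (boolP (inmid d1 d2 x)) => [xm|];
  by rewrite ?andbF //= inmE // -loopE //= ?eqb_id ?eqbF_neg.
Qed.
End Columns.

(* Otherwise a failed syntactic match makes the unifier unfold a whole graph search. *)
Local Opaque Defs.comp calpha cbeta.

Lemma eq_gconn2 (X : finType) (a b a' b' : X -> X) : a =1 a' -> b =1 b' ->
  gconn [:: a; b] =2 gconn [:: a'; b'].
Proof. by move=> aa bb; apply: eq_connect => x y /=; rewrite aa bb. Qed.

Lemma eq_offdiag (X : eqType) (f g : X -> X) :
  (forall u v, u != v -> (f u == v) = (g u == v)) -> f =1 g.
Proof.
move=> fg u; have [fu|fu] := eqVneq (f u) u; last by apply/esym/eqP; rewrite -fg // eq_sym.
have [gu|gu] := eqVneq (g u) u; first by rewrite fu gu.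
by apply/eqP; rewrite fg // eq_sym.
Qed.

(** * Associativity of gluing in a strip of four columns *)

Section FourColumns.
Variables (n : nat) (d1 d2 d3 : rbdiag n) (C : finType) (c0 c1 c2 c3 : C).
Hypotheses (c01 : c0 != c1) (c02 : c0 != c2) (c03 : c0 != c3).
Hypotheses (c12 : c1 != c2) (c13 : c1 != c3) (c23 : c2 != c3).

Let a := place c0 c1 d1.
Let b := place c1 c2 d2.
Let c := place c2 c3 d3.
Let M : pred (C * 'I_n) := fun y => y.1 == c1.
Let N : pred (C * 'I_n) := fun y => y.1 == c2.
Let R := gconn [:: a; b; c].
Let R' := gconn [:: c; b; a].

Let RR : R =2 R'.
Proof.
apply: eq_connect => x y /=; rewrite !orbF.
by case: (a x == y); case: (b x == y); case: (c x == y).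
Qed.

Let aK : involutive a. Proof. exact: placeK. Qed.
Let bK : involutive b. Proof. exact: placeK. Qed.
Let cK : involutive c. Proof. exact: placeK. Qed.

Let aN x : N x -> a x = x.
Proof. by move=> /eqP e; rewrite /a place_id // e eq_sym. Qed.

Let cM x : M x -> c x = x.
Proof. by move=> /eqP e; rewrite /c place_id // e. Qed.

Let MN x : M x -> ~~ N x. Proof. by rewrite /M /N => /eqP->. Qed.
Let NM x : N x -> ~~ M x. Proof. by rewrite /M /N => /eqP->; rewrite eq_sym. Qed.

Let abM x : ~~ M x -> (a x == x) || (b x == x).
Proof.
rewrite /M => xM; have [e|e] := eqVneq x.1 c0; last by rewrite /a place_id ?eqxx.
by rewrite orbC /b place_id ?e ?eqxx.
Qed.

Let cbN x : ~~ N x -> (c x == x) || (b x == x).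
Proof.
rewrite /N => xN; have [e|e] := eqVneq x.1 c3; last by rewrite /c place_id ?eqxx.
by rewrite orbC /b place_id ?e ?eqxx // eq_sym.
Qed.

Let h12 : contract a b M =1 place c0 c2 (Defs.comp d1 d2).
Proof. exact: contract_place. Qed.

Let h23 : contract c b N =1 place c1 c3 (Defs.comp d2 d3).
Proof. by move=> x; rewrite contractC; apply: contract_place. Qed.

Let conn_left x y : ~~ M x -> ~~ M y ->
  gconn [:: place c0 c2 (Defs.comp d1 d2); c] x y = R x y.
Proof.
move=> Mx My; rewrite /R (gconn3_contract aK bK abM cK cM Mx My).
exact/esym/(eq_gconn2 h12 (frefl c)).
Qed.

Let conn_right x y : ~~ N x -> ~~ N y ->
  gconn [:: a; place c1 c3 (Defs.comp d2 d3)] x y = R x y.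
Proof.
move=> Nx Ny; rewrite RR /R' (gconn3_contract cK bK cbN aK aN Nx Ny).
by rewrite [LHS]gconn_swap (eq_gconn2 h23 (frefl a)).
Qed.

Lemma dapp_comp_assoc (u v : vtx n) : u != v ->
  (dapp (Defs.comp (Defs.comp d1 d2) d3) u == v) =
  (dapp (Defs.comp d1 (Defs.comp d2 d3)) u == v).
Proof.
move=> uv; apply: etrans (dapp_comp (Defs.comp d1 d2) d3 c02 c23 c03 uv) _.
apply: etrans (esym (dapp_comp d1 (Defs.comp d2 d3) c01 c13 c03 uv)).
have embN w : ~~ N (emb c0 c3 w) by rewrite /N /emb; case: w.1; rewrite //= eq_sym.
have embM w : ~~ M (emb c0 c3 w) by rewrite /M /emb; case: w.1; rewrite //= eq_sym.
by rewrite conn_left // conn_right.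
Qed.

Definition count_mid (e e' : rbdiag n) (t : bool) : nat := if t then calpha e e' else cbeta e e'.

(** Both sums count the enclosed components of the whole strip: [nclass_contract] eliminates column
    [c1] on the left side and, for the mirrored triple [c], [b], [a], column [c2] on the right
    side. *)
Lemma count_mid_assoc t :
  (count_mid d1 d2 t + count_mid (Defs.comp d1 d2) d3 t =
   count_mid d2 d3 t + count_mid d1 (Defs.comp d2 d3) t)%N.
Proof.
rewrite /count_mid -(nclass_place _ _ c01 c12 c02) -(nclass_place _ _ c02 c23 c03).
rewrite -(nclass_place _ _ c12 c23 c13) -(nclass_place _ _ c01 c13 c03).
transitivity (nclass R (enclosed R (fun x => M x || N x) (moved3 a b c) t)).
  rewrite -(nclass_contract aK bK abM cK cM MN aN); congr (_ + _)%N.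
  apply: eq_nclass => [x y|//|x].
    by apply: eq_gconn2 => // z; rewrite h12.
  by rewrite /moved2 h12.
transitivity (nclass R' (enclosed R' (fun x => N x || M x) (moved3 c b a) t)).
  by apply: eq_nclass => [||x]; [exact: RR|move=> x; rewrite orbC|rewrite /moved3 orbC].
rewrite -(nclass_contract cK bK cbN aK aN NM cM); congr (_ + _)%N.
  by apply: eq_nclass => [x y|//|x]; [exact: gconn_swap|rewrite /moved2 andbC].
apply: eq_nclass => [x y|//|x].
  by rewrite gconn_swap; apply: eq_gconn2.
by rewrite /moved2 h23 andbC.
Qed.
End FourColumns.

Lemma comp_assoc n (d1 d2 d3 : rbdiag n) :
  Defs.comp (Defs.comp d1 d2) d3 = Defs.comp d1 (Defs.comp d2 d3).
Proof.
(* Pairs of booleans serve as the four distinct columns. *)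
have E := @dapp_comp_assoc n d1 d2 d3 (bool * bool)%type (false, false) (false, true)
  (true, false) (true, true) isT isT isT isT isT isT.
apply: dapp_inj; exact: eq_offdiag E.
Qed.

Lemma calpha_assoc n (d1 d2 d3 : rbdiag n) :
  (calpha d1 d2 + calpha (Defs.comp d1 d2) d3 = calpha d2 d3 + calpha d1 (Defs.comp d2 d3))%N.
Proof.
exact: (@count_mid_assoc n d1 d2 d3 (bool * bool)%type (false, false) (false, true)
  (true, false) (true, true) isT isT isT isT isT isT true).
Qed.

Lemma cbeta_assoc n (d1 d2 d3 : rbdiag n) :
  (cbeta d1 d2 + cbeta (Defs.comp d1 d2) d3 = cbeta d2 d3 + cbeta d1 (Defs.comp d2 d3))%N.
Proof.
exact: (@count_mid_assoc n d1 d2 d3 (bool * bool)%type (false, false) (false, true)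
  (true, false) (true, true) isT isT isT isT isT isT false).
Qed.

(** * Propagating edges and right link states *)

Section Propagating.
Variable n : nat.
Implicit Types (d : rbdiag n) (u : vtx n).

(** An edge within the left column survives as a path of the gluing; an isolated left vertex is
    moved by neither diagram, so its class is a single point. *)
Lemma dapp_comp_left d1 d2 u : ~~ u.1 -> ~~ (dapp d1 u).1 ->
  dapp (Defs.comp d1 d2) u = dapp d1 u.
Proof.
move=> uL duL; set w := dapp d1 u in duL *; apply/eqP.
have aw : place lvl0 lvl1 d1 (emb lvl0 lvl2 u) = emb lvl0 lvl2 w.
  rewrite (_ : emb lvl0 lvl2 u = emb lvl0 lvl1 u); last by rewrite /emb (negPf uL).
  by rewrite place_emb // /emb -/w (negPf duL).
have [uw|uw] := eqVneq u w; last first.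
  by rewrite (@dapp_comp _ _ lvl0 lvl1 lvl2) // gconn1 //= aw eqxx.
apply/negPn/negP; rewrite -uw => ne; move: (eqxx (dapp (Defs.comp d1 d2) u)).
rewrite {1}(@dapp_comp _ _ lvl0 lvl1 lvl2) 1?eq_sym //.
move/(gconn_ind (P := pred1 (emb lvl0 lvl2 u))) => H.
have /eqP/emb_inj : pred1 (emb lvl0 lvl2 u) (emb lvl0 lvl2 (dapp (Defs.comp d1 d2) u)).
  apply: H => [z /eqP->|] /=; last exact: eqxx.
  by rewrite aw -uw eqxx place_id ?eqxx //= /emb (negPf uL).
by move=> /(_ isT)/eqP; rewrite (negPf ne).
Qed.

Lemma dapp_comp_right d1 d2 u : u.1 -> (dapp d2 u).1 ->
  dapp (Defs.comp d1 d2) u = dapp d2 u.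
Proof.
move=> uR duR; set w := dapp d2 u in duR *; apply/eqP.
have aw : place lvl1 lvl2 d2 (emb lvl0 lvl2 u) = emb lvl0 lvl2 w.
  rewrite (_ : emb lvl0 lvl2 u = emb lvl1 lvl2 u); last by rewrite /emb uR.
  by rewrite place_emb // /emb -/w duR.
have [uw|uw] := eqVneq u w; last first.
  by rewrite (@dapp_comp _ _ lvl0 lvl1 lvl2) // gconn1 //= aw eqxx orbT.
apply/negPn/negP; rewrite -uw => ne; move: (eqxx (dapp (Defs.comp d1 d2) u)).
rewrite {1}(@dapp_comp _ _ lvl0 lvl1 lvl2) 1?eq_sym //.
move/(gconn_ind (P := pred1 (emb lvl0 lvl2 u))) => H.
have /eqP/emb_inj : pred1 (emb lvl0 lvl2 u) (emb lvl0 lvl2 (dapp (Defs.comp d1 d2) u)).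
  apply: H => [z /eqP->|] /=; last exact: eqxx.
  by rewrite aw -uw eqxx place_id ?eqxx //= /emb uR.
by move=> /(_ isT)/eqP; rewrite (negPf ne).
Qed.

Lemma prop_right d : prop d = #|[set j : 'I_n | ~~ (dapp d (true, j)).1]|.
Proof.
have dfst i : (dapp d (false, i)).1 -> dapp d (false, i) = (true, (dapp d (false, i)).2).
  by case: (dapp d _) => [[] j].
have dtst j : ~~ (dapp d (true, j)).1 -> dapp d (true, j) = (false, (dapp d (true, j)).2).
  by case: (dapp d _) => [[] i].
rewrite /prop; set A := [set i | _].
rewrite -(card_in_imset (f := fun i => (dapp d (false, i)).2) (D := A)); last first.
  move=> i i'; rewrite !inE => /dfst di /dfst di' e.
  have : dapp d (false, i) = dapp d (false, i') by rewrite di di' e.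
  by move/(inv_inj (dappK d)) => -[].
apply: eq_card => j; rewrite inE; apply/imsetP/idP => [[i]|/dtst dj].
  by rewrite inE => /dfst di ->; rewrite -di dappK.
by exists (dapp d (true, j)).2; rewrite ?inE -dj dappK.
Qed.

Lemma prop_comp_left d1 d2 : (prop (Defs.comp d1 d2) <= prop d1)%N.
Proof.
apply/subset_leq_card/subsetP => i; rewrite !inE; apply: contraLR => di.
by rewrite dapp_comp_left.
Qed.

Lemma prop_comp_right d1 d2 : (prop (Defs.comp d1 d2) <= prop d2)%N.
Proof.
rewrite !prop_right; apply/subset_leq_card/subsetP => i; rewrite !inE.
by apply: contra => di; rewrite dapp_comp_right.
Qed.

Lemma prop_full d : prop d = n -> forall i, (dapp d (false, i)).1.
Proof.
move=> dn i; have /eqP : [set i | (dapp d (false, i)).1] == [set: 'I_n].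
  by rewrite eqEcard subsetT cardsT card_ord /= -/(prop d) dn.
by move/setP/(_ i); rewrite !inE.
Qed.

Lemma prop_full_right d : prop d = n -> forall j, ~~ (dapp d (true, j)).1.
Proof.
rewrite prop_right => dn i; have /eqP : [set i | ~~ (dapp d (true, i)).1] == [set: 'I_n].
  by rewrite eqEcard subsetT cardsT card_ord /= dn.
by move/setP/(_ i); rewrite !inE.
Qed.

Lemma prop_comp_full d1 d2 : prop d1 = n -> prop d2 = n -> prop (Defs.comp d1 d2) = n.
Proof.
move=> /prop_full f1 /prop_full f2; rewrite -[RHS]card_ord -cardsT; apply: eq_card => i.
rewrite !inE; case E1: (dapp d1 (false, i)) (f1 i) => [[] j] //= _.
case E2: (dapp d2 (false, j)) (f2 j) => [[] l] //= _.
suff /eqP-> : dapp (Defs.comp d1 d2) (false, i) == (true, l) by [].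
rewrite (@dapp_comp _ _ lvl0 lvl1 lvl2) //; apply: (@gconn_trans _ _ (emb lvl0 lvl1 (true, j))).
  by rewrite gconn1 //= (@place_emb _ _ lvl0 lvl1 d1 (false, i)) // E1 eqxx.
by rewrite gconn1 //= (@place_emb _ _ lvl1 lvl2 d2 (false, j)) // E2 eqxx orbT.
Qed.

(** Every middle vertex reaches the left column through [d1]. Products with a permutation diagram on
    the left thus carry no [delta] or [eps], which the multiplicativity of the augmentation uses. *)
Lemma inmid_full d1 d2 x : prop d1 = n -> inmid d1 d2 x = false.
Proof.
move=> /prop_full_right f1; apply/negP => /forallP xm.
have /eqP x1 : middle x by have := xm x; rewrite /cconn connect0.
case E1: (dapp d1 (true, x.2)) (f1 x.2) => [[] i] //= _.
have /implyP := xm (lvl0, i); suff -> : cconn d1 d2 x (lvl0, i) by move/(_ isT).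
apply/connect1/orP; left; apply/existsP; exists (true, x.2).
by rewrite E1 /emb1 /= -x1 -surjective_pairing !eqxx.
Qed.

Lemma calpha_full d1 d2 : prop d1 = n -> calpha d1 d2 = 0%N.
Proof. by move=> f1; apply: eq_card0 => x; rewrite !inE inmid_full // andbF. Qed.

Lemma cbeta_full d1 d2 : prop d1 = n -> cbeta d1 d2 = 0%N.
Proof. by move=> f1; apply: eq_card0 => x; rewrite !inE inmid_full // andbF. Qed.

Definition defects (p : lstate n) : nat := #|[set a | p a == Some None]|.

Lemma defects_rls d : defects (rls d) = prop d.
Proof.
rewrite prop_right; apply: eq_card => j; rewrite !inE ffunE /=.
have [->//|] := eqVneq (dapp d (true, j)) (true, j).
by case: (dapp d (true, j)) => [[] i].
Qed.

Lemma defects_lstep p q : lstep p q -> (defects q < defects p)%N.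
Proof.
case/orP=> [/existsP[x /existsP[y /and4P[xy px py /eqP->]]]|/existsP[x /andP[px /eqP->]]].
  apply/proper_card/properP; split; last by exists x; rewrite !inE ?px // ffunE eqxx.
  apply/subsetP => z; rewrite !inE ffunE.
  by have [->|_] := eqVneq z x; [rewrite px | have [->|_] := eqVneq z y; rewrite ?py].
apply/proper_card/properP; split; last by exists x; rewrite !inE ?px // ffunE eqxx.
by apply/subsetP => z; rewrite !inE ffunE; have [->|_] := eqVneq z x; rewrite ?px.
Qed.

(** Every splice or deletion loses defects, so only the empty sequence keeps their number. *)
Lemma defects_connect p q : connect (@lstep n) p q -> q = p \/ (defects q < defects p)%N.
Proof.
case/connectP=> s + ->; elim: s p => [|r s IHs] p /=; first by left.
case/andP=> /defects_lstep pr /IHs[->|]; first by right.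
by move/ltn_trans/(_ pr); right.
Qed.

Lemma Jset_prop p i d : p \in Pset n i -> d \in Jset p -> (prop d <= i)%N.
Proof.
case/imsetP=> d0; rewrite !inE => /eqP<- ->.
by rewrite -!defects_rls => /defects_connect[->//|/ltnW].
Qed.

Lemma Jset_rls p i d : p \in Pset n i -> d \in Jset p -> prop d = i -> rls d = p.
Proof.
case/imsetP=> d0; rewrite !inE => /eqP<- -> /defects_connect[//|].
by rewrite !defects_rls => + e; rewrite e ltnn.
Qed.
End Propagating.

(** * The rook-Brauer algebra and its quotients *)

Section RookBrauerAlgebra.
Variables (k : comPzRingType) (n : nat) (delta eps : k).
Implicit Types (a b g d : rbdiag n) (x y z : RB k n).
Local Notation mul := (rbmul delta eps).
Local Notation basis := (@rbbasis k n).

Definition weight a b : k := delta ^+ calpha a b * eps ^+ cbeta a b.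

Lemma weight_assoc a b g :
  weight a b * weight (Defs.comp a b) g = weight b g * weight a (Defs.comp b g).
Proof.
have mulX (u v : nat) (u' v' : nat) : delta ^+ u * eps ^+ v * (delta ^+ u' * eps ^+ v') =
    delta ^+ (u + u') * eps ^+ (v + v').
  by rewrite !exprD; ring.
by rewrite /weight !mulX calpha_assoc cbeta_assoc.
Qed.

Lemma sum_rbbasis a (F : rbdiag n -> k) : \sum_d basis a d * F d = F a.
Proof.
rewrite (bigD1 a) //= ffunE eqxx mul1r big1 ?addr0 // => d /negPf da.
by rewrite ffunE da mul0r.
Qed.

Lemma sum_rbmul x y (F : rbdiag n -> k) :
  \sum_d mul x y d * F d =
  \sum_a \sum_b x a * y b * (weight a b * F (Defs.comp a b)).
Proof.
under eq_bigr => d _ do rewrite ffunE mulr_suml.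
rewrite exchange_big; apply: eq_bigr => a _ /=.
under eq_bigr => d _ do rewrite mulr_suml.
rewrite exchange_big; apply: eq_bigr => b _ /=.
rewrite (bigD1 (Defs.comp a b)) //= eqxx mulr1 big1 ?addr0 => [|d /negPf db].
  by rewrite -!mulrA.
by rewrite eq_sym db !(mulr0, mul0r).
Qed.

Lemma rbmulA x y z : mul (mul x y) z = mul x (mul y z).
Proof.
apply/ffunP => d; rewrite [LHS]ffunE [RHS]ffunE.
pose K a b : k := weight a b * ((Defs.comp a b == d) : nat)%:R.
have -> : \sum_a \sum_b mul x y a * z b * K a b =
    \sum_a mul x y a * \sum_b z b * K a b.
  by apply: eq_bigr => a _; rewrite mulr_sumr; apply: eq_bigr => b _; rewrite mulrA.
have -> : \sum_a \sum_b x a * mul y z b * K a b =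
    \sum_a x a * \sum_b mul y z b * K a b.
  by apply: eq_bigr => a _; rewrite mulr_sumr; apply: eq_bigr => b _; rewrite mulrA.
rewrite (sum_rbmul x y (fun a => \sum_b z b * K a b)).
apply: eq_bigr => a _; rewrite [X in _ = _ * X]sum_rbmul mulr_sumr.
apply: eq_bigr => b _; rewrite !mulr_sumr; apply: eq_bigr => g _.
rewrite /K comp_assoc; move: _%:R (weight_assoc a b g) => t.
move: (weight a b) (weight (Defs.comp a b) g) (weight b g) (weight a (Defs.comp b g)).
move=> u v u' v' e; transitivity (x a * y b * z g * t * (u * v)); first by ring.
by rewrite e; ring.
Qed.

Lemma rbmul_basisl a y d :
  mul (basis a) y d = \sum_b y b * (weight a b * ((Defs.comp a b == d) : nat)%:R).
Proof.
rewrite ffunE -[RHS](sum_rbbasis a (fun u =>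
  \sum_b y b * (weight u b * ((Defs.comp u b == d) : nat)%:R))).
by apply: eq_bigr => a' _; rewrite mulr_sumr; apply: eq_bigr => b _; rewrite -mulrA.
Qed.

Lemma rbmul_basis a b d : mul (basis a) (basis b) d = weight a b * ((Defs.comp a b == d) : nat)%:R.
Proof.
rewrite rbmul_basisl.
exact: (sum_rbbasis b (fun u => weight a u * ((Defs.comp a u == d) : nat)%:R)).
Qed.

Lemma inspan_basis (T : {set rbdiag n}) d : d \in T -> inspan T (basis d).
Proof.
move=> dT; apply/forallP => d'; apply/implyP; rewrite ffunE.
by have [->//|_] := eqVneq d' d; rewrite eqxx.
Qed.

Lemma inspan0 (T : {set rbdiag n}) x d : inspan T x -> d \notin T -> x d = 0.
Proof. by move=> /forallP/(_ d)/implyP xT dT; apply/eqP; apply: contraNT dT. Qed.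
End RookBrauerAlgebra.

Section Quotient.
Variables (k : comPzRingType) (n : nat) (delta eps : k) (S : {set rbdiag n}) (q : nat).
Local Notation mul := (rbmul delta eps).
Local Notation basis := (@rbbasis k n).
Local Notation weight := (weight delta eps).
Local Notation T := (qbasis S q).
Local Notation qm := (@qmul k n delta eps S q).
Hypothesis Smul : forall x y : RB k n, inspan S x -> inspan S y -> inspan S (mul x y).
Hypothesis qn : (q < n)%N.

Lemma sum_qbasis (F : rbdiag n -> k) :
  \sum_(t : T) F (val t) = \sum_(d | (d \in S) && (q <= prop d)%N) F d.
Proof.
rewrite (reindex_omap (val : T -> _) insub) => [|d Pd]; last by rewrite insubT.
by apply: eq_bigl => t; rewrite (valP t) valK eqxx.
Qed.

Lemma sum_qmul (a b : T) (F : rbdiag n -> k) : (forall d, (prop d < q)%N -> F d = 0) ->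
  \sum_t qm a b t * F (val t) =
  weight (val a) (val b) * F (Defs.comp (val a) (val b)).
Proof.
move=> F0; rewrite (sum_qbasis (fun d => mul (basis (val a)) (basis (val b)) d * F d)).
set ab := Defs.comp _ _; have term d : mul (basis (val a)) (basis (val b)) d * F d =
    if d == ab then weight (val a) (val b) * F ab else 0.
  rewrite rbmul_basis -/ab eq_sym; case: eqP => [->|_]; first by rewrite mulr1.
  by rewrite mulr0 mul0r.
rewrite (eq_bigr _ (fun d _ => term d)) -big_mkcondr /=.
have [Pab|nPab] := boolP ((ab \in S) && (q <= prop ab)%N).
  rewrite (eq_bigl (pred1 ab)) ?big_pred1_eq // => d.
  by rewrite andbC /=; have [->|//] := eqVneq d ab.
rewrite big1 => [|d /andP[Pd /eqP dab]]; last by rewrite -dab Pd in nPab.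
move: nPab; rewrite negb_and -ltnNge => /orP[abS|/F0->]; last by rewrite mulr0.
have [/andP[aS _] /andP[bS _]] := (valP a, valP b).
have := inspan0 (Smul (inspan_basis k aS) (inspan_basis k bS)) abS.
by rewrite rbmul_basis eqxx mulr1 => ->; rewrite mul0r.
Qed.

Lemma qmulE (a b t : T) : qm a b t =
  weight (val a) (val b) * ((Defs.comp (val a) (val b) == val t) : nat)%:R.
Proof. exact: rbmul_basis. Qed.

Lemma qmul_prop (a b t : T) : Defs.comp (val a) (val b) = val t ->
  (prop (val t) <= prop (val a))%N && (prop (val t) <= prop (val b))%N.
Proof. by move=> <-; rewrite prop_comp_left prop_comp_right. Qed.

(** A product with fewer than [q] propagating edges stays so after further multiplication on either
    side, so discarding it is harmless. *)
Lemma qmulA (a b c u : T) :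
  \sum_t qm a b t * qm t c u = \sum_t qm b c t * qm a t u.
Proof.
have uq : (q <= prop (val u))%N by have /andP[] := valP u.
rewrite (@sum_qmul a b (fun d => mul (basis d) (basis (val c)) (val u))).
  rewrite (@sum_qmul b c (fun d => mul (basis (val a)) (basis d) (val u))).
    by rewrite !rbmul_basis comp_assoc [LHS]mulrA [RHS]mulrA weight_assoc.
  move=> d dq; rewrite rbmul_basis; case: eqP => [e|_]; last by rewrite mulr0.
  by have := leq_ltn_trans (prop_comp_right (val a) d) dq; rewrite e ltnNge uq.
move=> d dq; rewrite rbmul_basis; case: eqP => [e|_]; last by rewrite mulr0.
by have := leq_ltn_trans (prop_comp_left d (val c)) dq; rewrite e ltnNge uq.
Qed.

Lemma prop_le (d : rbdiag n) : (prop d <= n)%N.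
Proof. by rewrite -[X in (_ <= X)%N]card_ord max_card. Qed.

Lemma qtauM (a b : T) : \sum_t qm a b t * qtau k t = qtau k a * qtau k b.
Proof.
rewrite (@sum_qmul a b (fun d => ((prop d == n) : nat)%:R)) => [|d dq]; last first.
  by rewrite (ltn_eqF (ltn_trans dq qn)).
rewrite /qtau; have [ea|na] := eqVneq (prop (val a)) n.
  have [eb|nb] := eqVneq (prop (val b)) n.
    by rewrite prop_comp_full // eqxx /weight calpha_full // cbeta_full // !mulr1.
  rewrite (ltn_eqF (leq_ltn_trans (prop_comp_right _ _) _)) ?mulr0 //.
  by rewrite ltn_neqAle nb prop_le.
rewrite (ltn_eqF (leq_ltn_trans (prop_comp_left _ _) _)) ?mulr0 ?mul0r //.
by rewrite ltn_neqAle na prop_le.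
Qed.

Section Idempotents.
Variable e : lstate n -> RB k n.
Let good p := (p \in Pset n q) && [exists d in S, rls d == p].
Hypothesis eP : forall p, good p ->
  [/\ inspan S (e p), mul (e p) (e p) = e p &
      forall x : RB k n,
        (inspan S x /\ inspan (Jset p) x) <->
        (exists2 a : RB k n, inspan S a & x = mul a (e p))].

(** [low] and [idem_of] instantiate the ideal [J] and the coefficients [e] of the homotopy. *)
Let low (x : T) := prop (val x) == q.
Let idem_of (x v : T) := e (rls (val x)) (val v).

Let good_rls x : low x -> good (rls (val x)).
Proof.
move=> /eqP xq; apply/andP; split; last first.
  by apply/exists_inP; exists (val x) => //; have /andP[] := valP x.
by apply/imsetP; exists (val x); rewrite ?inE ?xq.
Qed.

Let idem_span p : good p -> inspan S (e p) /\ inspan (Jset p) (e p).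
Proof. by case/eP => eS ee ex; apply/ex; exists (e p). Qed.

Let basis_span x : low x -> inspan S (basis (val x)) /\ inspan (Jset (rls (val x))) (basis (val x)).
Proof.
move=> _; split; apply: inspan_basis; first by have /andP[] := valP x.
by rewrite inE connect0.
Qed.

Let mul_idem p x : good p -> inspan S x -> inspan (Jset p) x -> mul x (e p) = x.
Proof.
case/eP => eS ee ex xS xJ; have [a aS ->] := (ex x).1 (conj xS xJ).
by rewrite rbmulA ee.
Qed.

Lemma qmul_lowl (a x t : T) : low x -> ~~ low t -> qm a x t = 0.
Proof.
rewrite /low qmulE => /eqP xq tq.
case: eqP => [/qmul_prop/andP[_]|_]; last by rewrite mulr0.
by rewrite xq leq_eqVlt (negPf tq) ltnNge; have /andP[_ ->] := valP t.
Qed.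

Lemma qmul_lowr (x a t : T) : low x -> ~~ low t -> qm x a t = 0.
Proof.
rewrite /low qmulE => /eqP xq tq.
case: eqP => [/qmul_prop/andP[+ _]|_]; last by rewrite mulr0.
by rewrite xq leq_eqVlt (negPf tq) ltnNge; have /andP[_ ->] := valP t.
Qed.

Lemma idem_of_high (x v : T) : low x -> ~~ low v -> idem_of x v = 0.
Proof.
move=> lx; rewrite /low => vq; have gx := good_rls lx; have [_ eJ] := idem_span gx.
apply: inspan0 eJ _; apply: contra vq; have /andP[pP _] := gx => /(Jset_prop pP) vq.
by rewrite eqn_leq vq; have /andP[_ ->] := valP v.
Qed.

Lemma qmul_idem_of (x t : T) : low x -> \sum_v idem_of x v * qm x v t = (t == x)%:R.
Proof.
move=> lx; have gx := good_rls lx; have [eS _] := idem_span gx; have [xS xJ] := basis_span lx.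
have tq : (q <= prop (val t))%N by have /andP[] := valP t.
rewrite (sum_qbasis (fun d => e (rls (val x)) d * mul (basis (val x)) (basis d) (val t))).
transitivity (mul (basis (val x)) (e (rls (val x))) (val t)); last first.
  by rewrite mul_idem // ffunE val_eqE.
(* A diagram missing from the quotient basis is outside [S], where the idempotent has coefficient 0,
   or has too few propagating edges to contribute to [t]. *)
rewrite rbmul_basisl big_mkcond /=; apply: eq_bigr => d _; rewrite rbmul_basis.
case: ifP => // /negbT; rewrite negb_and -ltnNge => /orP[dS|dq].
  by rewrite (inspan0 eS dS) mul0r.
case: eqP => [E|_]; last by rewrite !mulr0.
by have := leq_ltn_trans (prop_comp_right (val x) d) dq; rewrite E ltnNge tq.
Qed.

(* [A x] lies in [A e_p = A cap J_p], so left multiplication preserves right link states. *)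
Lemma idem_of_qmul (a x t v : T) :
  low x -> low t -> qm a x t * idem_of t v = qm a x t * idem_of x v.
Proof.
move=> lx lt; have [->|nz] := eqVneq (qm a x t) 0; first by rewrite !mul0r.
have gx := good_rls lx; have [xS xJ] := basis_span lx.
suff tx : rls (val t) = rls (val x) by rewrite /idem_of tx.
have /andP[pP _] := gx; apply: (Jset_rls pP); last exact/eqP.
have aS : inspan S (basis (val a)) by apply: inspan_basis; have /andP[] := valP a.
have [_ _ ex] := eP gx; have [_ axJ] : inspan S (mul (basis (val a)) (basis (val x))) /\
    inspan (Jset (rls (val x))) (mul (basis (val a)) (basis (val x))).
  apply/ex; exists (mul (basis (val a)) (basis (val x))); first exact: Smul.
  by rewrite rbmulA mul_idem.
by apply: contraNT nz => tJ; apply/eqP/(inspan0 axJ tJ).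
Qed.

Lemma ext_iso_levels j : ExtIsoLevels delta eps S q q.+1 j.
Proof.
have wid (b : qbasis S q.+1) : (val b \in S) && (q <= prop (val b))%N.
  by have /andP[-> /ltnW] := valP b.
pose i (b : qbasis S q.+1) : T := exist _ (val b) (wid b).
apply: (@ext_iso_excision k _ _ _ _ _ _ low idem_of i (fun a => insub (val a))).
- exact: qmulA.
- exact: qtauM.
- exact: qmul_lowl.
- exact: qmul_lowr.
- by move=> x /eqP xq; rewrite /qtau xq (ltn_eqF qn).
- exact: idem_of_high.
- exact: qmul_idem_of.
- exact: idem_of_qmul.
- by move=> b; apply: valK.
- move=> a; rewrite /low => aq.
  have aP : (val a \in S) && (q < prop (val a))%N.
    by have /andP[-> qa] := valP a; rewrite ltn_neqAle eq_sym aq.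
  by rewrite insubT; congr Some; apply: val_inj.
- by move=> b; rewrite /low /= neq_ltn orbC; have /andP[_ ->] := valP b.
- by [].
by [].
Qed.
End Idempotents.
End Quotient.

Theorem theorem7p1 (k : comPzRingType) (n l m : nat) (delta eps : k)
    (S : {set rbdiag n}) :
  (l <= m)%N -> (m <= n - 1)%N -> (0 < n)%N ->
  (* A = span S is a unital subalgebra of RB_n(delta, eps) *)
  inspan S (rbone k n) ->
  (forall x y : RB k n, inspan S x -> inspan S y ->
     inspan S (rbmul delta eps x y)) ->
  (* hypothesis (ii) *)
  (forall i : nat, (l <= i <= m)%N ->
   forall p : lstate n, p \in Pset n i ->
   (exists2 d, d \in S & rls d = p) ->
   exists e : RB k n,
     [/\ inspan S e, rbmul delta eps e e = e &
         forall x : RB k n,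
           (inspan S x /\ inspan (Jset p) x) <->
           (exists2 a : RB k n, inspan S a & x = rbmul delta eps a e)]) ->
  (* Ext over A/(A cap I_{q-1}) ~= Ext over A/(A cap I_q), for l <= q <= m,
     in every degree j *)
  forall q : nat, (l <= q <= m)%N ->
  forall j : nat, ExtIsoLevels delta eps S q q.+1 j.
Proof.
move=> _ mn n0 _ Smul idem q qlm j.
have qn : (q < n)%N by case/andP: qlm => _ qm; rewrite -(prednK n0) ltnS -subn1 (leq_trans qm).
pose good p := (p \in Pset n q) && [exists d in S, rls d == p].
(* The condition on [p] is moved under the existential, with [rbone] as dummy value, so that finite
   choice gives idempotents for all link states at once. *)
have idem_good (p : lstate n) : exists u : RB k n, good p ->
    [/\ inspan S u, rbmul delta eps u u = u &
         forall x : RB k n,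
           (inspan S x /\ inspan (Jset p) x) <->
           (exists2 a : RB k n, inspan S a & x = rbmul delta eps a u)].
  have [/andP[pP /exists_inP[d dS /eqP dp]]|ngp] := boolP (good p); last by exists (rbone k n).
  by have [|e eP] := idem q qlm p pP; [exists d | exists e].
have [e eP] := fin_all_exists idem_good.
exact: (@ext_iso_levels k n delta eps S q Smul qn e eP j).
Qed.
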